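(* If a random continuous function $\mathcal{L}$ on $\Lambda\times I$ (with $\Lambda\subset\mathbb{Z}$ and $I\subset\mathbb{R}$ possibly infinite intervals) is in the class $\mathbf{LC}$, then any finite-dimensional marginal distribution of $\mathcal{L}$ is log-concave.
   Context: A finite-dimensional marginal of $\mathcal{L}=\{\mathcal{L}_j(t)\}$ is the law of $(\mathcal{L}_{j_1}(t_1),\dots,\mathcal{L}_{j_n}(t_n))$ for finitely many points $(j_i,t_i)\in\Lambda\times I$. A probability measure $\nu$ on $\mathbb{R}^n$ is log-concave if $\nu(\theta A+(1-\theta)B)\ge\nu(A)^\theta\nu(B)^{1-\theta}$ for all nonempty compact $A,B\subset\mathbb{R}^n$ and $\theta\in(0,1)$. For integers $k\le\ell$ and reals $a<b$ put $J=\{k,k+1,\dots,\ell\}$, $R=J\times[a,b]$. $C(R)$ denotes the continuous functions $z:J\times[a,b]\to\mathbb{R}$; write $z_j(t)=z(j,t)$ and $z(t)=(z_k(t),\dots,z_\ell(t))\in\mathbb{R}^J$. $C_0(R)=\{z\in C(R):z(a)=0\}$, $C_{0,0}(R)=\{z\in C(R):z(a)=z(b)=0\}$. Free case: for $\mathsf{s}=(R,x,\eta)$ with $x\in\mathbb{R}^J$, $\eta\in C_0(R)$, $\gamma_{\mathsf{s}}$ is the law on $C(R)$ of $\{B_j(t)+x_j+\eta_j(t)\}_{j\in J,t\in[a,b]}$, $B_j$ independent Brownian motions with diffusion constant 1 and $B_j(a)=0$. $\mathsf{S}^R$ is the set of such triples. Bridge case: for $\breve{\mathsf{s}}=(R,x,y,\breve\eta)$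 with $x,y\in\mathbb{R}^J$, $\breve\eta\in C_{0,0}(R)$, $\gamma_{\breve{\mathsf{s}}}$ is the law of $\{\breve B_j(t)+\frac{(b-t)x_j+(t-a)y_j}{b-a}+\breve\eta_j(t)\}$, $\breve B_j$ independent Brownian bridges (diffusion constant 1) on $[a,b]$ vanishing at $a,b$. $\breve{\mathsf{S}}^R$ is the set of such tuples. $\mathsf{H}^R$ is the set of functionals on $C(R)$ of the form $\mathbf{H}(z)=\sum_{i=1}^mf_i(z(t_i))+\int_a^bF(t,z(t))\,dt$ with $m\in\mathbb{N}_0$, $t_i\in[a,b]$, $f_i:\mathbb{R}^J\to\mathbb{R}$ convex, $F:[a,b]\times\mathbb{R}^J\to\mathbb{R}$ continuous and convex in the second variable for each fixed $t$. The measures $e^{-\mathbf{H}}\gamma_{\mathsf{s}}$, $e^{-\mathbf{H}}\gamma_{\breve{\mathsf{s}}}$ have finite total mass; $\mu_{\mathsf{s},\mathbf{H}}$, $\mu_{\breve{\mathsf{s}},\mathbf{H}}$ are the probability measures proportional to them. Local weak convergence: let $\Lambda_i\subset\mathbb{Z}$, $I_i\subset\mathbb{R}$ be (possibly infinite) intervals and $\mu_i$ Borel probability measures on $C(\Lambda_i\times I_i,\mathbb{R})$, $i\in\mathbb{N}\cup\{\infty\}$. $\mu_i\to\mu_\infty$ locally weakly if $\Lambda_i\times I_i\subset\Lambda_\infty\times I_\infty$ for all $i$, every compact $K\subset\Lambda_\infty\times I_\infty$ is contained in $\Lambda_i\times I_i$ for $i$ large, and the marginal law of $\mu_i$ on $C(K,\mathbb{R})$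 converges weakly to that of $\mu_\infty$ for every such $K$. Class $\mathbf{LC}$: let $\mathring{\mathfrak{M}}$ be the collection of all measures $\mu_{\mathsf{s},\mathbf{H}}$ and $\mu_{\breve{\mathsf{s}},\mathbf{H}}$ (over all $R$, $\mathsf{s}\in\mathsf{S}^R$, $\breve{\mathsf{s}}\in\breve{\mathsf{S}}^R$, $\mathbf{H}\in\mathsf{H}^R$), and $\mathfrak{M}$ the collection of locally weak limits of sequences in $\mathring{\mathfrak{M}}$. A random continuous function is in the class $\mathbf{LC}$ if its law belongs to $\mathfrak{M}$. *)

(* Defs.v *)
From HB Require Import structures.
From mathcomp Require Import all_boot all_order all_algebra.
From mathcomp Require Import all_classical all_reals all_analysis.
Import numFieldNormedType.Exports.
Set Implicit Arguments.
Unset Strict Implicit.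
Unset Printing Implicit Defensive.
Import Order.TTheory GRing.Theory Num.Theory.
Local Open Scope classical_set_scope.
Local Open Scope ring_scope.

Notation plane R := (discrete_topology int * R)%type.

(* C(D, R): continuous functions on D with its relative topology, under
   uniform convergence on compact sets. *)
Definition cfun (R : realType) (D : set (plane R)) : Type :=
  continuousType D R.

HB.instance Definition _ (R : realType) (D : set (plane R)) :=
  Choice.on (cfun D).
HB.instance Definition _ (R : realType) (D : set (plane R)) :=
  Topological.copy (cfun D)
    (@initial_topology (cfun D) {compact-open, D -> R} id).
HB.instance Definition _ (R : realType) (D : set (plane R)) :=
  isPointed.Build (cfun D) (mkcts (@cst_continuous D R 0)).

Definition borel (T : ptopologicalType) := g_sigma_algebraType (@open T).

Lemma continuous_borel (S T : ptopologicalType) (f : S -> T) :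
  continuous f -> measurable_fun setT (f : borel S -> borel T).
Proof.
move=> /continuousP cf.
apply: (@measurability _ _ (borel S) (borel T) setT f (@open T)) => //.
move=> _ [U oU <-]; rewrite setTI.
by apply: sub_sigma_algebra; exact: cf.
Qed.

Lemma cvg_cfun (R : realType) (D : set (plane R)) (z : cfun D)
    (K : set D) (O : set R) :
  compact K -> open O -> z @` K `<=` O ->
  \forall y \near z, (y : cfun D) @` K `<=` O.
Proof.
move=> cK oO zKO.
have : (id : cfun D -> {compact-open, D -> R}) y @[y --> z] -->
       (id z : {compact-open, D -> R}).
  exact: (@initial_continuous (cfun D) {compact-open, D -> R} id z).
move=> zz; have [h _] := @compact_open_cvgP D R (y @[y --> z]) z _.
exact: h.
Qed.

Lemma subfun_continuous (R : realType) (K D : set (plane R))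
  (s : K `<=` D) : continuous (subfun s).
Proof.
apply: continuous_comp_initial.
rewrite (_ : _ \o _ = set_val); first exact: initial_continuous.
by apply/funext => -[].
Qed.

Definition restr (R : realType) (K D : set (plane R)) (s : K `<=` D)
    (z : borel (cfun D)) : borel (cfun K) :=
  (z : cfun D) \o mkcts (@subfun_continuous R K D s) : cfun K.

Lemma restr_continuous (R : realType) (K D : set (plane R)) (s : K `<=` D) :
  continuous (restr s : cfun D -> cfun K).
Proof.
apply: continuous_comp_initial => z.
apply: (@compact_open_cvgP K R _ (restr s z)
  (fmap_filter _ (@nbhs_filter (cfun D) z))).2 => C O cC oO zCO.
rewrite -image_comp in zCO.
have cKC : compact (subfun s @` C).
  apply: continuous_compact => //.
  exact/continuous_subspaceT/subfun_continuous.
apply: filterS (cvg_cfun cKC oO zCO) => y.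
by rewrite /= -image_comp.
Qed.

HB.instance Definition _ (R : realType) (K D : set (plane R)) (s : K `<=` D) :=
  isMeasurableFun.Build _ _ _ _ (restr s) (continuous_borel (@restr_continuous R K D s)).

Definition eval_at (R : realType) (D : set (plane R)) (n : nat)
    (p : 'I_n -> D) (z : borel (cfun D)) : borel 'rV[R]_n :=
  \row_i (z : cfun D) (p i).

Lemma eval_at_continuous (R : realType) (D : set (plane R)) n (p : 'I_n -> D) :
  continuous (eval_at p : cfun D -> 'rV[R]_n).
Proof.
move=> z A [P Pz PA].
have : \forall y \near z, forall i, (P ord0 i)° ((y : cfun D) (p i)).
  apply: (@filter_forall _ _ _ (nbhs z)) => i.
  have zU : (z : cfun D) @` [set p i] `<=` (P ord0 i)°.
    by move=> _ [_ -> <-]; have := Pz ord0 i; rewrite mxE.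
  apply: filterS (cvg_cfun (@compact_set1 _ (p i)) (open_interior _) zU).
  by move=> y; apply; exists (p i).
apply: filterS => y Py; apply: PA => k i; rewrite ord1 mxE.
by exact: interior_subset.
Qed.

HB.instance Definition _ (R : realType) (D : set (plane R)) (n : nat)
    (p : 'I_n -> D) :=
  isMeasurableFun.Build _ _ _ _ (eval_at p)
    (continuous_borel (@eval_at_continuous R D n p)).

Definition log_concave (R : realType) (n : nat)
    (nu : probability (borel 'rV[R]_n) R) : Prop :=
  forall (A B : set 'rV[R]_n) (theta : R),
    A !=set0 -> compact A -> B !=set0 -> compact B -> 0 < theta < 1 ->
    (nu A `^ theta * nu B `^ (1 - theta)%R
       <= nu [set (theta *: x + (1 - theta) *: y)%R | x in A & y in B])%E.

Definition weak_cvg (R : realType) (T : ptopologicalType)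
    (mu : nat -> probability (borel T) R) (nu : probability (borel T) R) :
    Prop :=
  forall phi : T -> R, continuous phi -> (exists M, forall z, `|phi z| <= M) ->
    (\int[mu i]_z (phi z)%:E)%E @[i --> \oo] --> (\int[nu]_z (phi z)%:E)%E.

Definition locally_weak_cvg (R : realType) (D : nat -> set (plane R))
    (mu : forall i, probability (borel (cfun (D i))) R)
    (E : set (plane R)) (nu : probability (borel (cfun E)) R) : Prop :=
  (forall i, D i `<=` E) /\
  forall (K : set (plane R)) (KE : K `<=` E), compact K ->
    exists N (KD : forall i, K `<=` D (N + i)%N),
      weak_cvg (fun i => distribution (mu (N + i)%N) (restr (KD i)))
               (distribution nu (restr KE)).

Definition mutually_independent (R : realType) d (T : measurableType d)
    (P : probability T R) (I : finType) (F : I -> set (set T)) : Prop :=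
  forall (J : {set I}) (A : I -> set T), (forall i, i \in J -> F i (A i)) ->
    P (\bigcap_(i in [set` J]) A i) = (\prod_(i in J) P (A i))%E.

(* Diffusion constant 1: W t - W s has variance t - s, and normal_prob takes the
   standard deviation. *)
Record brownian (R : realType) d (T : measurableType d)
    (P : probability T R) (a b : R) (W : R -> T -> R) : Prop := Brownian {
  brownian_measurable :
    forall t, t \in `[a, b] -> measurable_fun setT (W t);
  brownian_start : forall w, W a w = 0;
  brownian_path : forall w, {within `[a, b], continuous (W ^~ w)};
  brownian_normal : forall s t, a <= s -> s < t -> t <= b ->
    forall A, measurable A ->
      P [set w | A (W t w - W s w)] = normal_prob 0 (Num.sqrt (t - s)) A;
  brownian_indep : forall (n : nat) (tau : nat -> R),
    {homo tau : i j / (i <= j)%N >-> i <= j} ->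
    (forall i, tau i \in `[a, b]) ->
    mutually_independent P (fun i : 'I_n =>
      preimage_set_system setT (fun w => W (tau i.+1) w - W (tau i) w)
        measurable)
}.

Definition process_sigma (R : realType) d (T : measurableType d) (a b : R)
    (W : R -> T -> R) : set (set T) :=
  <<s \bigcup_(t in `[a, b]) preimage_set_system setT (W t) measurable >>.

Definition independent_brownian (R : realType) d (T : measurableType d)
    (P : probability T R) (a b : R) (m : nat) (B : 'I_m -> R -> T -> R) :
    Prop :=
  (forall i, brownian P a b (B i)) /\
  mutually_independent P (fun i => process_sigma a b (B i)).

(* If W is a Brownian motion on [a, b], this is a Brownian bridge vanishing at
   both ends; independent motions give independent bridges. *)
Definition bridge (R : realType) (T : Type) (a b : R) (W : R -> T -> R) :
    R -> T -> R :=
  fun t w => W t w - (t - a) / (b - a) * W b w.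

Record rectangle (R : realType) := Rectangle {
  lo : int;
  hi : int;
  left_end : R;
  right_end : R;
  lo_le_hi : lo <= hi;
  left_lt_right : left_end < right_end
}.

Definition dom (R : realType) (r : rectangle R) : set (plane R) :=
  [set` `[lo r, hi r]] `*` `[left_end r, right_end r].

(* Vectors in R^J, J = {lo, ..., hi}, are row vectors whose i-th entry is the
   one of index lo + i in J. *)
Definition width (R : realType) (r : rectangle R) : nat := `|hi r - lo r|.+1.

Definition site (R : realType) (r : rectangle R) (i : 'I_(width r)) : int :=
  lo r + i%:Z.

(* z_j(t) for j = site i; meaningful for t in [a, b], extended by 0. *)
Definition line (R : realType) (r : rectangle R) (z : cfun (dom r))
    (i : 'I_(width r)) (t : R) : R :=
  'valL_0 z (site i, t).

Definition slice (R : realType) (r : rectangle R) (z : cfun (dom r)) (t : R) :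
    'rV[R]_(width r) :=
  \row_i line z i t.

Definition C0 (R : realType) (r : rectangle R) : set (cfun (dom r)) :=
  [set z | slice z (left_end r) = 0].

Definition C00 (R : realType) (r : rectangle R) : set (cfun (dom r)) :=
  [set z | slice z (left_end r) = 0 /\ slice z (right_end r) = 0].

Definition law_of (R : realType) (r : rectangle R) d (T : measurableType d)
    (P : probability T R) (Y : 'I_(width r) -> R -> T -> R)
    (gamma : probability (borel (cfun (dom r))) R) : Prop :=
  exists X : {RV P >-> borel (cfun (dom r))},
    (forall w i t, t \in `[left_end r, right_end r] ->
       line (X w) i t = Y i t w) /\
    (forall A, measurable A -> gamma A = distribution P X A).

Definition free_law (R : realType) (r : rectangle R) (x : 'rV[R]_(width r))
    (eta : cfun (dom r)) (gamma : probability (borel (cfun (dom r))) R) :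
    Prop :=
  exists d (T : measurableType d) (P : probability T R)
    (B : 'I_(width r) -> R -> T -> R),
    independent_brownian P (left_end r) (right_end r) B /\
    law_of P (fun i t w => B i t w + x 0 i + line eta i t) gamma.

Definition bridge_law (R : realType) (r : rectangle R)
    (x y : 'rV[R]_(width r)) (eta : cfun (dom r))
    (gamma : probability (borel (cfun (dom r))) R) : Prop :=
  let a := left_end r in let b := right_end r in
  exists d (T : measurableType d) (P : probability T R)
    (B : 'I_(width r) -> R -> T -> R),
    independent_brownian P a b B /\
    law_of P (fun i t w => bridge a b (B i) t w
      + ((b - t) * x 0 i + (t - a) * y 0 i) / (b - a) + line eta i t) gamma.

Definition convex_functional (R : realType) (r : rectangle R)
    (H : cfun (dom r) -> R) : Prop :=
  let a := left_end r in let b := right_end r in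
  exists (m : nat) (t : 'I_m -> R) (f : 'I_m -> 'rV[R]_(width r) -> R)
    (F : R * 'rV[R]_(width r) -> R),
    [/\ (forall i, t i \in `[a, b]),
        (forall i, convex_function setT (f i)),
        {within `[a, b] `*` setT, continuous F},
        (forall s, s \in `[a, b] ->
           convex_function setT (fun v : 'rV[R]_(width r) => F (s, v))) &
        forall z, H z = \sum_i f i (slice z (t i)) +
          \int[lebesgue_measure]_(s in `[a, b]) F (s, slice z s)].

(* c is the inverse of the total mass of e^{-H} gamma: since mu is a probability
   measure, that mass is positive and finite. *)
Definition tilted (R : realType) (r : rectangle R)
    (gamma : probability (borel (cfun (dom r))) R) (H : cfun (dom r) -> R)
    (mu : probability (borel (cfun (dom r))) R) : Prop :=
  exists2 c : R, 0 < c & forall A, measurable A ->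
    mu A = (c%:E * \int[gamma]_(z in A) (expR (- H z))%:E)%E.

Definition basic_measure (R : realType) (r : rectangle R)
    (mu : probability (borel (cfun (dom r))) R) : Prop :=
  exists (gamma : probability (borel (cfun (dom r))) R)
    (H : cfun (dom r) -> R),
    [/\ (exists x eta, C0 eta /\ free_law x eta gamma) \/
        (exists x y eta, C00 eta /\ bridge_law x y eta gamma),
        convex_functional H & tilted gamma H mu].

Definition LC (R : realType) (D : set (plane R))
    (nu : probability (borel (cfun D)) R) : Prop :=
  exists (r : nat -> rectangle R)
    (mu : forall i, probability (borel (cfun (dom (r i)))) R),
    (forall i, basic_measure (mu i)) /\ locally_weak_cvg mu nu.

(* Main.v *)
(** The Prekopa-Leindler inequality holds on the line by the one-dimensional
    Brunn-Minkowski inequality for superlevel sets, normalized to have supremum 1,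
    together with the AM-GM inequality; multiplying by a log-concave density gives it
    for centered normal laws. It tensorizes by Fubini, hence holds for the independent
    increments of independent Brownian motions on a finite grid of times, and it is
    inherited by the affine images of these increments, among which are the
    finite-dimensional marginals of the free and bridge measures. A weight
    exp(- H) with H convex preserves it: after truncating H from below and
    discretizing its time integral, the weight is a bounded log-concave function of
    finitely many coordinates, and both approximations are removed by dominated
    convergence. Applied to indicator functions this gives the set inequality for the
    basic measures, and it passes to weak limits by comparing a compact set with its
    small neighbourhoods through Lipschitz cutoffs. *)
Require Import Defs.
From HB Require Import structures.
From mathcomp Require Import all_boot all_order all_algebra.
From mathcomp Require Import all_classical all_reals all_analysis.
From mathcomp Require Import measurable_realfun ring lra zify.
Import numFieldNormedType.Exports.
Set Implicit Arguments.
Unset Strict Implicit.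
Unset Printing Implicit Defensive.
Import Order.TTheory GRing.Theory Num.Theory.
Local Open Scope classical_set_scope.
Local Open Scope ring_scope.

(** * One-dimensional Prekopa-Leindler inequality *)

(** The inequality for sets does not go through Fubini directly, so its functional form is carried
    up to the weighted marginals, for bounded functions so that all integrals against probabilities
    are finite. No marginal is described by a density: a bridge pinned at both ends, the
    deterministic value at the starting time and repeated points give degenerate laws, all of which
    affine images of independent increments cover.

    The functional [H] sees the whole path, whereas the inequality is available only for finitely
    many values. The evaluation points are therefore enlarged by the sampling times of [H]; the
    extra coordinates need no separate marginalization, since the indicator of [A] ignores them.

    Minkowski combinations of measurable sets need not be measurable. Inequalities between
    measurable sets thus speak of an arbitrary measurable [C] containing the combination of [A] and
    [B]; for the compact sets of the final statement the combination is itself compact. *)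

Lemma lebesgue_measure_affine (R : realType) (a c : R) (A : set R) :
  0 < a -> measurable A ->
  lebesgue_measure [set x | A ((x - c) / a)] = (a%:E * lebesgue_measure A)%E.
Proof.
move=> a0 mA.
pose phi : measurableTypeR R -> measurableTypeR R := fun x => (x - c) / a.
have mphi : measurable_fun setT phi.
  by apply: measurable_funM => //; exact: measurable_funB.
have ai0 : 0 <= a^-1 by rewrite invr_ge0 ltW.
pose m := mscale (NngNum ai0) (pushforward lebesgue_measure phi).
(* The rescaled pushforward agrees with Lebesgue measure on half-open intervals, hence everywhere by
   uniqueness. *)
have mE X : measurable X -> lebesgue_measure X = m mphi X.
  apply: lebesgue_measure_unique => _ [[s t] _ <-].
  rewrite /m /= /mscale /pushforward.
  rewrite [X in (_ * lebesgue_measure X)%E](_ : _ =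
      `]a * s + c, a * t + c]%classic); last first.
    apply/seteqP; split => x /=; rewrite !in_itv /= /phi ltr_pdivlMr // ler_pdivrMr //.
      by move=> /andP[h1 h2]; apply/andP; split; lra.
    by move=> /andP[h1 h2]; apply/andP; split; lra.
  rewrite !lebesgue_measure_itv /= !lte_fin ltrD2r ltr_pM2l //.
  case: ifP => _; last by rewrite mule0.
  by rewrite -!EFinB -EFinM; congr (_%:E); field; rewrite gt_eqF.
rewrite [in RHS]mE // /m /mscale /= /pushforward muleA -EFinM.
by rewrite mulfV ?gt_eqF // mul1e.
Qed.

Lemma brunn_minkowski_bounded (R : realType) (theta : R) (A B C : set R) :
  0 < theta < 1 -> measurable A -> measurable B -> measurable C ->
  A !=set0 -> B !=set0 -> has_ubound A -> has_lbound B ->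
  (forall x y, A x -> B y -> C (theta * x + (1 - theta) * y)) ->
  (theta%:E * lebesgue_measure A + (1 - theta)%:E * lebesgue_measure B
    <= lebesgue_measure C)%E.
Proof.
move=> /andP[t0 t1] mA mB mC A0 B0 ubA lbB ABC.
have u0 : 0 < 1 - theta by rewrite subr_gt0.
apply/lee_addgt0Pr => e e0.
(* Supremum and infimum need not be attained. Points within [e] of them lose at most [e] of measure
   in each cut, and the weights [theta] and [1 - theta] turn the two losses into a single [e]. *)
have [a Aa aA] := sup_adherent e0 (conj A0 ubA).
have [b Bb bB] := inf_adherent e0 (conj B0 lbB).
have splitA : (lebesgue_measure A <= lebesgue_measure (A `&` `]-oo, a]) + e%:E)%E.
  rewrite -[X in (lebesgue_measure X <= _)%E](setUIDK A `]-oo, a]).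
  apply: le_trans (measureU2 _ _ _) _; [exact: measurableI|exact: measurableD|].
  apply: leeD => //.
  apply: (@le_trans _ _ (lebesgue_measure `]a, (sup A)])).
    apply: le_measure; rewrite ?inE //; first exact: measurableD.
    move=> x [Ax] /=; rewrite !in_itv /= => /negP; rewrite -ltNge => -> /=.
    exact: ub_le_sup.
  rewrite lebesgue_measure_itv /=; case: ifP => _; rewrite ?lee_fin; last exact: ltW.
  by lra.
have splitB : (lebesgue_measure B <= lebesgue_measure (B `&` `]b, +oo[) + e%:E)%E.
  rewrite -[X in (lebesgue_measure X <= _)%E](setUIDK B `]b, +oo[).
  apply: le_trans (measureU2 _ _ _) _; [exact: measurableI|exact: measurableD|].
  apply: leeD => //.
  apply: (@le_trans _ _ (lebesgue_measure `[(inf B), b])).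
    apply: le_measure; rewrite ?inE //; first exact: measurableD.
    move=> x [Bx] /=; rewrite !in_itv /= andbT => /negP; rewrite -leNgt => -> /=.
    by rewrite andbT; apply: ge_inf.
  rewrite lebesgue_measure_itv /=; case: ifP => _; rewrite ?lee_fin; last exact: ltW.
  by lra.
(* [C] contains copies of [theta A] near [(1 - theta) b] and of [(1 - theta) B]
   near [theta a], which are disjoint once [A] is cut above [a] and [B] below [b]. *)
pose C1 := [set x | (A `&` `]-oo, a]) ((x - (1 - theta) * b) / theta)].
pose C2 := [set x | (B `&` `]b, +oo[) ((x - theta * a) / (1 - theta))].
have mC1 : measurable C1.
  rewrite /C1 -[X in measurable X]setTI.
  apply: (_ : measurable_fun setT (fun x : R => (x - (1 - theta) * b) / theta)) => //.
    by apply: measurable_funM => //; exact: measurable_funB.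
  exact: measurableI.
have mC2 : measurable C2.
  rewrite /C2 -[X in measurable X]setTI.
  apply: (_ : measurable_fun setT (fun x : R => (x - theta * a) / (1 - theta))) => //.
    by apply: measurable_funM => //; exact: measurable_funB.
  exact: measurableI.
have C12 : C1 `|` C2 `<=` C.
  move=> x [[Ax _]|[Bx _]].
    rewrite (_ : x = theta * ((x - (1 - theta) * b) / theta) + (1 - theta) * b); last first.
      by field; rewrite gt_eqF.
    exact: ABC.
  rewrite (_ : x = theta * a + (1 - theta) * ((x - theta * a) / (1 - theta))); last first.
    by field; rewrite gt_eqF.
  exact: ABC.
(* The point [theta * a + (1 - theta) * b] separates the two copies; the cut of [B] is open at [b],
   so only [C1] can contain it. *)
have dC : [disjoint C1 & C2].
  apply/disj_setPS => x [[_ /=]]; rewrite in_itv /= => h1 [_ /=].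
  rewrite in_itv /= andbT => h2.
  by rewrite ler_pdivrMr // in h1; rewrite ltr_pdivlMr // in h2; lra.
have lC : (theta%:E * lebesgue_measure (A `&` `]-oo, a]) +
   (1 - theta)%:E * lebesgue_measure (B `&` `]b, +oo[) <= lebesgue_measure C)%E.
  apply: (@le_trans _ _ (lebesgue_measure (C1 `|` C2))); last first.
    by apply: le_measure => //; rewrite inE //; exact: measurableU.
  rewrite measureU //; last exact/disj_set2P.
  rewrite -(lebesgue_measure_affine ((1 - theta) * b) t0); last exact: measurableI.
  by rewrite -(lebesgue_measure_affine (theta * a) u0) //; exact: measurableI.
apply: le_trans (leeD (lee_wpmul2l _ splitA) (lee_wpmul2l _ splitB)) _;
  rewrite ?lee_fin ?(ltW t0) ?(ltW u0) //.
rewrite !ge0_muleDr ?lee_fin ?(ltW e0) //.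
rewrite addeACA -!EFinM -EFinD -mulrDl subrKC mul1r.
exact: leeD.
Qed.

Lemma brunn_minkowski1 (R : realType) (theta : R) (A B C : set R) :
  0 < theta < 1 -> measurable A -> measurable B -> measurable C ->
  A !=set0 -> B !=set0 ->
  (forall x y, A x -> B y -> C (theta * x + (1 - theta) * y)) ->
  (theta%:E * lebesgue_measure A + (1 - theta)%:E * lebesgue_measure B
    <= lebesgue_measure C)%E.
Proof.
move=> t01 mA mB mC [a Aa] [b Bb] ABC; have /andP[t0 t1] := t01.
(* Windows centred at a point of each set keep the truncations nonempty, as the bounded case
   requires. *)
pose T c (D : set R) (n : nat) := D `&` `[c - n%:R, c + n%:R].
have mT c D n : measurable D -> measurable (T c D n).
  by move=> mD; exact: measurableI.
have Tcvg c D : measurable D ->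
    lebesgue_measure (T c D n) @[n --> \oo] --> lebesgue_measure D.
  move=> mD; rewrite [X in _ --> lebesgue_measure X](_ : _ = \bigcup_n T c D n); last first.
    apply/seteqP; split => [x Dx|x [n _ []] //].
    exists (Num.trunc `|x - c|).+1 => //; split=> //=; rewrite in_itv /=.
    have := truncnS_gt `|x - c|; rewrite ltr_norml => /andP[h1 h2].
    by apply/andP; split; lra.
  apply: nondecreasing_cvg_mu.
  - by move=> n; exact: mT.
  - by apply: bigcup_measurable => n _; exact: mT.
  - move=> m n mn; apply/subsetPset => x [Dx]; rewrite /T /= !in_itv /= => /andP[h1 h2].
    have : (m%:R : R) <= n%:R by rewrite ler_nat.
    by split => //; apply/andP; split; lra.
have cv : (theta%:E * lebesgue_measure (T a A n) +
    (1 - theta)%:E * lebesgue_measure (T b B n))%E @[n --> \oo] -->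
    (theta%:E * lebesgue_measure A + (1 - theta)%:E * lebesgue_measure B)%E.
  apply: cvgeD; [|by apply: cvgeZl => //; exact: Tcvg..].
  by apply: ge0_adde_def; rewrite inE mule_ge0 // lee_fin ?subr_ge0 ltW.
apply: (cvge_to_le cv); apply: nearW => n.
apply: brunn_minkowski_bounded => //; try exact: mT.
- by exists a; split => //=; rewrite in_itv /=; have := ler0n R n; lra.
- by exists b; split => //=; rewrite in_itv /=; have := ler0n R n; lra.
- by exists (a + n%:R) => x [_] /=; rewrite in_itv /= => /andP[].
- by exists (b - n%:R) => x [_] /=; rewrite in_itv /= => /andP[].
- by move=> x y [Ax _] [By _]; exact: ABC.
Qed.

Section layer_cake.
Context (R : realType) d (T : measurableType d).
Implicit Types (m mu : {sigma_finite_measure set T -> \bar R}).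

Let hypograph (f : T -> R) : set (T * measurableTypeR R) :=
  [set z | 0 < z.2 < f z.1].

Let measurable_hypograph (f : T -> R) :
  measurable_fun setT f -> measurable (hypograph f).
Proof.
move=> mf; pose b (z : T * measurableTypeR R) := (0 < z.2) && (z.2 < f z.1).
rewrite (_ : hypograph f = b @^-1` [set true]); last first.
  by apply/seteqP; split.
rewrite -[X in measurable X]setTI; apply: (_ : measurable_fun setT b) => //.
apply: measurable_and; apply: measurable_fun_ltr => //.
exact: measurableT_comp.
Qed.

Let integral_hypograph (f : T -> R) x :
  (0 <= f x) -> (\int[lebesgue_measure]_t (\1_(hypograph f) (x, t))%:E)%E = (f x)%:E.
Proof.
move=> fx0; transitivity (\int[lebesgue_measure]_t (\1_(`]0, f x[%classic) t)%:E)%E.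
  apply: eq_integral => t _; congr (_%:E); rewrite !indicE; congr (_%:R); congr (nat_of_bool _).
rewrite integral_indic // setIT -[LHS]/(lebesgue_measure `]0, f x[%classic).
rewrite lebesgue_measure_itv /= lte_fin.
by case: ltP => [_|h]; [rewrite sube0|congr (_%:E); apply/eqP; rewrite eq_le h fx0].
Qed.

(** Tonelli for the indicator of the region below the graph: its section over [x] has length [f x],
    its section at a level [t > 0] is a superlevel set. *)
Lemma layer_cake m (f : T -> R) : measurable_fun setT f -> (forall x, 0 <= f x) ->
  (\int[m]_x (f x)%:E = \int[lebesgue_measure]_(t in `]0%R, +oo[) m [set x | t < f x]%R)%E.
Proof.
move=> mf f0.
transitivity (\int[m]_x \int[lebesgue_measure]_t (\1_(hypograph f) (x, t))%:E)%E.
  by apply: eq_integral => x _; rewrite integral_hypograph.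
rewrite (fubini_tonelli (fun z : T * measurableTypeR R => (\1_(hypograph f) z)%:E))%E //=.
  rewrite [RHS]integral_mkcond; apply: eq_integral => t _; rewrite patchE.
  rewrite (eq_integral (fun x => (\1_([set x | 0 < t < f x]) x)%:E)) //.
  rewrite integral_indic // ?setIT.
    case: ifPn => [|]; rewrite ?inE ?notin_setE /= in_itv /= andbT.
      by move=> ->.
    move=> /negP/negPf->; rewrite (_ : [set _ | _] = set0) ?measure0 //.
    by apply/seteqP; split.
  rewrite -[X in measurable X]setTI.
  apply: (_ : measurable_fun setT (fun x => (0 < t) && (t < f x))) => //.
  apply: measurable_and => //; exact: measurable_fun_ltr.
by apply/measurable_EFinP/measurable_indic; exact: measurable_hypograph.
Qed.

(** Superlevel sets are sections of one measurable subset of the product, and the measure of a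
    section depends measurably on the level. *)
Lemma measurable_fun_tail m (f : T -> R) (D : set R) : measurable_fun setT f ->
  measurable D -> measurable_fun D (fun t => m [set x | t < f x]).
Proof.
move=> mf mD; apply: measurable_funTS.
pose H := [set z : T * measurableTypeR R | z.2 < f z.1].
have mH : measurable H.
  rewrite -[X in measurable X]setTI.
  apply: (_ : measurable_fun setT (fun z : T * measurableTypeR R => z.2 < f z.1)) => //.
  by apply: measurable_fun_ltr => //; exact: measurableT_comp.
rewrite (_ : (fun t => _) = m \o ysection H); first exact: measurable_fun_ysection.
by apply/funext => t; congr (m _); apply/seteqP; split => x; rewrite /ysection /= inE.
Qed.

(** The density is given on sets only. Slicing both integrals by levels with Tonelli reduces the
    claim to superlevel sets, where the hypothesis applies. *)
Lemma integral_density m mu (p f : T -> R) :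
  measurable_fun setT p -> (forall x, 0 <= p x) ->
  (forall A, measurable A -> m A = \int[mu]_(x in A) (p x)%:E)%E ->
  measurable_fun setT f -> (forall x, 0 <= f x) ->
  (\int[m]_x (f x)%:E = \int[mu]_x (p x * f x)%:E)%E.
Proof.
move=> mp p0 mE mf f0.
transitivity (\int[m]_x \int[lebesgue_measure]_t (\1_(hypograph f) (x, t))%:E)%E.
  by apply: eq_integral => x _; rewrite integral_hypograph.
rewrite (fubini_tonelli (fun z : T * measurableTypeR R => (\1_(hypograph f) z)%:E))%E //=; last first.
  by apply/measurable_EFinP/measurable_indic; exact: measurable_hypograph.
transitivity (\int[mu]_x \int[lebesgue_measure]_t (p x * \1_(hypograph f) (x, t))%:E)%E; last first.
  apply: eq_integral => x _; under eq_integral do rewrite EFinM.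
  rewrite ge0_integralZl ?integral_hypograph ?lee_fin //.
  apply/measurable_EFinP.
  apply: (measurableT_comp (f := \1_(hypograph f) : T * measurableTypeR R -> R)).
    by apply: measurable_indic; exact: measurable_hypograph.
  exact: pair1_measurable.
rewrite (fubini_tonelli (fun z : T * measurableTypeR R => (p z.1 * \1_(hypograph f) z)%:E))%E //=.
- apply: eq_integral => t _.
  have mH : measurable [set x | 0 < t < f x].
    rewrite -[X in measurable X]setTI.
    apply: (_ : measurable_fun setT (fun x => (0 < t) && (t < f x))) => //.
    by apply: measurable_and => //; exact: measurable_fun_ltr.
  rewrite (eq_integral (fun x => (\1_([set x | 0 < t < f x]) x)%:E)) //.
  transitivity (m [set x | 0 < t < f x]); first by rewrite integral_indic // setIT.
  rewrite mE // integral_mkcond.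
  apply: eq_integral => x _; rewrite patchE indicE.
  rewrite (_ : ((x, t) \in hypograph f) = (x \in [set x | 0 < t < f x])); last first.
    by apply/idP/idP; rewrite !inE.
  by case: ifP; rewrite ?mulr1 ?mulr0.
- apply/measurable_EFinP/measurable_funM; first exact: measurableT_comp.
  by apply: measurable_indic; exact: measurable_hypograph.
- by move=> z; rewrite lee_fin mulr_ge0.
Qed.

End layer_cake.

(** Young's inequality with the conjugate exponents [theta^-1] and [(1 - theta)^-1]. *)
Lemma weighted_AMGM (R : realType) (theta x y : R) : 0 < theta < 1 ->
  0 <= x -> 0 <= y ->
  x `^ theta * y `^ (1 - theta) <= theta * x + (1 - theta) * y.
Proof.
move=> /andP[t0 t1] x0 y0; have u0 : 0 < 1 - theta by rewrite subr_gt0.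
have := @conjugate_powR R (x `^ theta) (y `^ (1 - theta)) theta^-1 (1 - theta)^-1.
rewrite -!powRrM !mulfV ?gt_eqF // !powRr1 // !invrK !powR_ge0 !invr_gt0 => h.
by rewrite [theta * x]mulrC [(1 - theta) * y]mulrC h //; lra.
Qed.

(* An arbitrary interpolation map [mid] in place of [theta x + (1 - theta) y]
   makes the property stable under products and under images by interpolation
   preserving maps, without any linear structure. *)
Definition prekopa_leindler (R : realType) (theta : R) d (T : measurableType d)
    (mu : {measure set T -> \bar R}) (mid : T -> T -> T) : Prop :=
  forall (f g h : T -> R) (M : R),
    measurable_fun setT f -> measurable_fun setT g -> measurable_fun setT h ->
    (forall x, 0 <= f x <= M) -> (forall x, 0 <= g x <= M) ->
    (forall x, 0 <= h x <= M) ->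
    (forall x y, f x `^ theta * g y `^ (1 - theta) <= h (mid x y)) ->
    (\int[mu]_x f x) `^ theta * (\int[mu]_x g x) `^ (1 - theta) <= \int[mu]_x h x.

(** The constant is the supremum of [f], positive because [f] is nonnegative and not identically
    zero. *)
Lemma sup_normalize (R : realType) (f : R -> R) (M : R) (x : R) :
  (forall x, 0 <= f x <= M) -> f x != 0 ->
  exists s : R, [/\ 0 < s, forall x, f x <= s & forall t, t < 1 -> exists x, s * t < f x].
Proof.
move=> fM fx0.
have sf : has_sup (range f).
  by split; [exists (f x); exists x|exists M => _ [y _ <-]; case/andP: (fM y)].
have ub y : f y <= sup (range f) by apply: ub_le_sup; [case: sf|exists y].
have s0 : 0 < sup (range f).
  apply: lt_le_trans (ub x); rewrite lt_neqAle eq_sym fx0.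
  by case/andP: (fM x).
exists (sup (range f)); split=> // t t1.
have e0 : 0 < sup (range f) * (1 - t) by rewrite mulr_gt0 // subr_gt0.
have [_ [y _ <-] h] := sup_adherent e0 sf.
by exists y; rewrite mulrBr mulr1 subKr in h.
Qed.

(** Brunn-Minkowski needs two nonempty sets. With the common supremum 1, the superlevel sets of [f]
    and [g] are both nonempty for [t < 1] and both empty afterwards, so no level has exactly one of
    them empty. The bound obtained involves the arithmetic mean of the integrals, which dominates
    the geometric one. *)
Lemma prekopa_leindler_normalized (R : realType) (theta : R) (f g h : R -> R) :
  0 < theta < 1 ->
  measurable_fun setT f -> measurable_fun setT g -> measurable_fun setT h ->
  (forall x, 0 <= f x <= 1) -> (forall x, 0 <= g x <= 1) -> (forall x, 0 <= h x) ->
  (forall t, t < 1 -> exists x, t < f x) ->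
  (forall t, t < 1 -> exists x, t < g x) ->
  (forall x y, f x `^ theta * g y `^ (1 - theta) <= h (theta * x + (1 - theta) * y)) ->
  (theta%:E * \int[lebesgue_measure]_x (f x)%:E
   + (1 - theta)%:E * \int[lebesgue_measure]_x (g x)%:E
   <= \int[lebesgue_measure]_x (h x)%:E)%E.
Proof.
move=> t01 mf mg mh f01 g01 h0 fsup gsup fgh; have /andP[t0 t1] := t01.
have u0 : 0 < 1 - theta by rewrite subr_gt0.
have f0 x : 0 <= f x by case/andP: (f01 x).
have g0 x : 0 <= g x by case/andP: (g01 x).
rewrite !layer_cake //.
pose L (k : R -> R) (t : R) : \bar R := lebesgue_measure [set x | t < k x].
have mset (k : R -> R) t : measurable_fun setT k -> measurable [set x | t < k x].
  move=> mk; rewrite -[X in measurable X]setTI.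
  by apply: (_ : measurable_fun setT (fun x => t < k x)) => //; exact: measurable_fun_ltr.
have mL (k : R -> R) D : measurable D -> measurable_fun setT k -> measurable_fun D (L k).
  by move=> mD mk; exact: measurable_fun_tail.
rewrite -!ge0_integralZl // ?lee_fin ?(ltW t0) ?(ltW u0) //; last 2 first.
  exact: mL.
  exact: mL.
rewrite -ge0_integralD //=; last 4 first.
  by move=> x _; rewrite mule_ge0 // lee_fin ltW.
  by apply: measurable_funeM; exact: mL.
  by move=> x _; rewrite mule_ge0 // lee_fin ltW.
  by apply: measurable_funeM; exact: mL.
apply: ge0_le_integral => //=.
- by move=> x _; rewrite adde_ge0 // mule_ge0 // lee_fin ltW.
- by apply: emeasurable_funD; apply: measurable_funeM; exact: mL.
- exact: mL.
move=> t; rewrite in_itv /= andbT => tpos.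
have [tl1|tge1] := ltP t 1.
  apply: brunn_minkowski1 => //; try exact: mset.
  - exact: fsup.
  - exact: gsup.
  - move=> x y /= tf tg; apply: lt_le_trans (fgh x y).
    have tE : t = t `^ theta * t `^ (1 - theta).
      by rewrite -powRD ?subrKC ?powRr1 ?oner_eq0 // ltW.
    rewrite [X in X < _]tE.
    rewrite ltr_pM ?powR_ge0 // gt0_ltr_powR // nnegrE ?ltW //.
      exact: lt_trans tf.
    exact: lt_trans tg.
have L0 (k : R -> R) : (forall x, 0 <= k x <= 1) -> [set x | t < k x] = set0.
  move=> k01; apply/seteqP; split=> // x /= tk; have := lt_le_trans tk (andP (k01 x)).2.
  by rewrite ltNge tge1.
have z : lebesgue_measure (set0 : set R) = 0%E by exact: measure0.
by rewrite (L0 f) // (L0 g) // z !mule0 adde0.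
Qed.

Lemma prekopa_leindler_lebesgue (R : realType) (theta M : R) (f g h : R -> R) :
  0 < theta < 1 ->
  lebesgue_measure.-integrable setT (EFin \o f) ->
  lebesgue_measure.-integrable setT (EFin \o g) ->
  lebesgue_measure.-integrable setT (EFin \o h) ->
  (forall x, 0 <= f x <= M) -> (forall x, 0 <= g x <= M) -> (forall x, 0 <= h x) ->
  (forall x y, f x `^ theta * g y `^ (1 - theta) <= h (theta * x + (1 - theta) * y)) ->
  (\int[lebesgue_measure]_x f x) `^ theta * (\int[lebesgue_measure]_x g x) `^ (1 - theta)
  <= \int[lebesgue_measure]_x h x.
Proof.
move=> t01 If Ig Ih fM gM h0 fgh; have /andP[t0 t1] := t01.
have u0 : 0 < 1 - theta by rewrite subr_gt0.
have mf : measurable_fun setT f by apply/measurable_EFinP; exact: measurable_int If.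
have mg : measurable_fun setT g by apply/measurable_EFinP; exact: measurable_int Ig.
have mh : measurable_fun setT h by apply/measurable_EFinP; exact: measurable_int Ih.
have f0 x : 0 <= f x by case/andP: (fM x).
have g0 x : 0 <= g x by case/andP: (gM x).
have intz (k : R -> R) : (forall x, k x = 0) -> \int[lebesgue_measure]_x k x = 0.
  by move=> kz; under eq_Rintegral do rewrite kz; rewrite Rintegral_cst // mul0r.
have [fz|/existsNP[xf /eqP fxf]] := pselect (forall x, f x = 0).
  by rewrite intz // powR0 ?gt_eqF // mul0r Rintegral_ge0.
have [gz|/existsNP[xg /eqP gxg]] := pselect (forall x, g x = 0).
  by rewrite [X in _ * X `^ _]intz // powR0 ?gt_eqF // mulr0 Rintegral_ge0.
have [s [s0 fs fsup]] := sup_normalize fM fxf.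
have [u [v0 gu gsup]] := sup_normalize gM gxg.
(* Homogeneity: [f / s], [g / u] and [h / w] still satisfy the pointwise hypothesis, and both sides
   of the conclusion are divided by the same [w]. *)
pose w := s `^ theta * u `^ (1 - theta).
have w0 : 0 < w by rewrite mulr_gt0 // powR_gt0.
have := @prekopa_leindler_normalized R theta (fun x => s^-1 * f x) (fun x => u^-1 * g x)
  (fun x => w^-1 * h x) t01.
have nrm (k : R -> R) (c : R) : 0 < c -> (forall x, 0 <= k x) ->
    lebesgue_measure.-integrable setT (EFin \o k) ->
    (\int[lebesgue_measure]_x (c^-1 * k x)%:E = (c^-1 * \int[lebesgue_measure]_x k x)%:E)%E.
  move=> c0 k0 Ik; under eq_integral do rewrite EFinM.
  rewrite integralZl // EFinM; congr (_ * _)%E.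
  by rewrite /Rintegral fineK //; exact: integrable_fin_num.
rewrite !nrm // -!EFinM -EFinD lee_fin => PL.
move: PL; set If' := \int[lebesgue_measure]_x f x.
set Ig' := \int[lebesgue_measure]_x g x; set Ih' := \int[lebesgue_measure]_x h x => PL.
have If0 : 0 <= If' by exact: Rintegral_ge0.
have Ig0 : 0 <= Ig' by exact: Rintegral_ge0.
have : (s^-1 * If') `^ theta * (u^-1 * Ig') `^ (1 - theta) <= w^-1 * Ih'.
  apply: le_trans (weighted_AMGM t01 _ _) _.
  - by rewrite mulr_ge0 ?invr_ge0 // ltW.
  - by rewrite mulr_ge0 ?invr_ge0 // ltW.
  apply: PL.
  - exact: measurable_funM.
  - exact: measurable_funM.
  - exact: measurable_funM.
  - by move=> x; rewrite mulr_ge0 ?invr_ge0 ?(ltW s0) //= mulrC ler_pdivrMr // mul1r.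
  - by move=> x; rewrite mulr_ge0 ?invr_ge0 ?(ltW v0) //= mulrC ler_pdivrMr // mul1r.
  - by move=> x; rewrite mulr_ge0 ?invr_ge0 ?(ltW w0).
  - by move=> t /fsup[x hx]; exists x; rewrite mulrC ltr_pdivlMr // mulrC.
  - by move=> t /gsup[x hx]; exists x; rewrite mulrC ltr_pdivlMr // mulrC.
  - move=> x y; rewrite !powRM ?invr_ge0 ?(ltW s0) ?(ltW v0) //.
    rewrite mulrACA -!powR_inv1 ?(ltW s0) ?(ltW v0) ?(ltW w0) // -!powRrM.
    rewrite [- 1 * _]mulrC [- 1 * (1 - _)]mulrC !powRrM -powRM ?powR_ge0 //.
    by rewrite ler_wpM2l ?powR_ge0.
rewrite !powRM ?invr_ge0 ?(ltW s0) ?(ltW v0) //.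
rewrite mulrACA -!powR_inv1 ?(ltW s0) ?(ltW v0) ?(ltW w0) // -!powRrM.
rewrite [- 1 * _]mulrC [- 1 * (1 - _)]mulrC !powRrM -powRM ?powR_ge0 //.
by rewrite ler_pM2l ?powR_gt0.
Qed.

Lemma prekopa_leindler_normal (R : realType) (theta sigma : R) :
  0 < theta < 1 -> sigma != 0 ->
  prekopa_leindler theta (normal_prob 0 sigma : {measure set _ -> \bar R})
    (fun x y => theta * x + (1 - theta) * y).
Proof.
move=> t01 s0 f g h M mf mg mh fM gM hM fgh; have /andP[t0 t1] := t01.
pose p := normal_pdf 0 sigma.
have p0 x : 0 <= p x by exact: normal_pdf_ge0.
have mp : measurable_fun setT p by exact: measurable_normal_pdf.
have E (k : R -> R) : measurable_fun setT k -> (forall x, 0 <= k x <= M) ->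
  lebesgue_measure.-integrable setT (EFin \o (fun x => p x * k x)) /\
  \int[normal_prob 0 sigma]_x k x = \int[lebesgue_measure]_x (p x * k x).
  move=> mk kM; split; last first.
    rewrite /Rintegral (integral_density (mu := lebesgue_measure) mp) //.
    by move=> x; case/andP: (kM x).
  have IMp : lebesgue_measure.-integrable setT (EFin \o (fun x => M * p x)).
    rewrite (_ : _ \o _ = (fun x => M%:E * (p x)%:E)%E).
      by apply: integrableZl => //; exact: integrable_normal_pdf.
    by [].
  apply: le_integrable IMp => //.
    by apply/measurable_EFinP; exact: measurable_funM.
  move=> x _ /=; case/andP: (kM x) => k0 k1; have M0 := le_trans k0 k1.
  by rewrite lee_fin !ger0_norm ?mulr_ge0 // mulrC ler_wpM2r.
have [If ->] := E f mf fM; have [Ig ->] := E g mg gM; have [Ih ->] := E h mh hM.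
apply: (@prekopa_leindler_lebesgue R theta (normal_peak sigma * M)) => //.
- move=> x; case/andP: (fM x) => f0 f1; rewrite mulr_ge0 //=.
  by rewrite ler_pM // normal_pdf_ub.
- move=> x; case/andP: (gM x) => f0 f1; rewrite mulr_ge0 //=.
  by rewrite ler_pM // normal_pdf_ub.
- by move=> x; rewrite mulr_ge0 //; case/andP: (hM x).
move=> x y; case/andP: (fM x) => f0 _; case/andP: (gM y) => g0 _.
rewrite !powRM // mulrACA ler_pM ?mulr_ge0 ?powR_ge0 //.
rewrite /p !normal_pdfE // !powRM ?normal_peak_ge0 ?expR_ge0 // mulrACA -powRD; last first.
  by rewrite subrKC oner_eq0.
rewrite subrKC powRr1 ?normal_peak_ge0 // ler_wpM2l ?normal_peak_ge0 //.
rewrite /normal_fun !subr0 -!expRM -expRD ler_expR.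
have k0 : 0 <= (sigma ^+ 2 *+ 2)^-1 by rewrite invr_ge0 mulrn_wge0 // sqr_ge0.
rewrite -subr_ge0; move: k0; set k := (_ *+ 2)^-1 => k0.
(* Log-concavity of the Gaussian density is the variance identity [theta x^2 + (1 - theta) y^2 -
   (theta x + (1 - theta) y)^2 = theta (1 - theta) (x - y)^2]. *)
rewrite [leRHS](_ : _ = k * (theta * (1 - theta) * (x - y) ^+ 2)); last by ring.
by rewrite mulr_ge0 // mulr_ge0 ?sqr_ge0 // mulr_ge0 ?(ltW t0) // subr_ge0 ltW.
Qed.

(** * Products and independent families *)

(** The conclusion is the pointwise hypothesis at [(a, a)]. This serves the zero increments between
    equal grid times and the one-point space from which products are built. *)
Lemma prekopa_leindler_dirac (R : realType) (theta : R) d (T : measurableType d) (a : T)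
    (mu : {measure set T -> \bar R}) (mid : T -> T -> T) :
  (forall A, measurable A -> mu A = \d_a A) -> mid a a = a -> prekopa_leindler theta mu mid.
Proof.
move=> muE aa f g h M mf mg mh fM gM hM fgh.
have E (k : T -> R) : measurable_fun setT k -> \int[mu]_x k x = k a.
  move=> mk; rewrite /Rintegral (eq_measure_integral (\d_a : {measure set T -> \bar R})).
    by rewrite integral_dirac // ?diracT ?mul1e //; exact/measurable_EFinP.
  by move=> A mA _; exact: muE.
by rewrite !E // -{3}aa.
Qed.

Lemma prekopa_leindler_pushforward (R : realType) (theta : R) d1 d2
    (T1 : measurableType d1) (T2 : measurableType d2) (phi : T1 -> T2)
    (mu : {measure set T1 -> \bar R}) (nu : {measure set T2 -> \bar R})
    (mid1 : T1 -> T1 -> T1) (mid2 : T2 -> T2 -> T2) :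
  measurable_fun setT phi ->
  (forall A, measurable A -> nu A = mu (phi @^-1` A)) ->
  (forall x y, phi (mid1 x y) = mid2 (phi x) (phi y)) ->
  prekopa_leindler theta mu mid1 -> prekopa_leindler theta nu mid2.
Proof.
move=> mphi nuE phiM PL f g h M mf mg mh fM gM hM fgh.
have E (k : T2 -> R) : measurable_fun setT k -> (forall x, 0 <= k x <= M) ->
    \int[nu]_x k x = \int[mu]_x k (phi x).
  move=> mk kM; rewrite /Rintegral.
  rewrite (eq_measure_integral (pushforward mu phi : {measure set T2 -> \bar R})); last first.
    by move=> A mA _; exact: nuE.
  rewrite ge0_integral_pushforward //; first exact/measurable_EFinP.
  by move=> x _; rewrite lee_fin; case/andP: (kM x).
rewrite !E //; apply: (PL _ _ _ M); rewrite //; try exact: measurableT_comp.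
by move=> x y /=; rewrite phiM.
Qed.

(** For fixed [x] and [y] the sections [f (x, .)], [g (y, .)] and [h (mid1 x y, .)] satisfy the
    hypothesis on the second factor. The resulting inequality is exactly the hypothesis for the
    partial integrals on the first; the bound [M] survives because [nu] has mass 1. *)
Lemma prekopa_leindler_prod (R : realType) (theta : R) d1 d2
    (T1 : measurableType d1) (T2 : measurableType d2)
    (mu : probability T1 R) (nu : probability T2 R)
    (m : {measure set (T1 * T2) -> \bar R})
    (mid1 : T1 -> T1 -> T1) (mid2 : T2 -> T2 -> T2) :
  (forall A B, measurable A -> measurable B -> m (A `*` B) = (mu A * nu B)%E) ->
  prekopa_leindler theta mu mid1 -> prekopa_leindler theta nu mid2 ->
  prekopa_leindler theta m (fun x y => (mid1 x.1 y.1, mid2 x.2 y.2)).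
Proof.
move=> mE PL1 PL2 f g h M mf mg mh fM gM hM fgh.
pose S (k : T1 * T2 -> R) x := \int[nu]_y k (x, y).
have P (k : T1 * T2 -> R) : measurable_fun setT k -> (forall x, 0 <= k x <= M) ->
    [/\ measurable_fun setT (S k), forall x, 0 <= S k x <= M &
      \int[m]_z k z = \int[mu]_x S k x].
  move=> mk kM.
  have k0 z : 0 <= k z by case/andP: (kM z).
  have mk1 x : measurable_fun setT (fun y => k (x, y)).
    exact: measurableT_comp mk (pair1_measurable x).
  have SM x : 0 <= S k x <= M.
    rewrite /S Rintegral_ge0 //=.
    rewrite /Rintegral -lee_fin fineK.
      apply: (@le_trans _ _ (\int[nu]_y (cst M%:E) y)%E).
        apply: ge0_le_integral => //=.
        - by move=> y _; rewrite lee_fin.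
        - exact/measurable_EFinP.
        - by move=> y _; rewrite lee_fin; case/andP: (kM (x, y)).
      by rewrite integral_cst //= probability_setT mule1.
    apply: integrable_fin_num => //.
    apply: (@le_integrable _ _ _ nu setT _ _ (EFin \o cst M)) => //.
    - exact/measurable_EFinP.
    - move=> y _ /=; rewrite lee_fin ger0_norm //.
      by case/andP: (kM (x, y)) => a b; rewrite (le_trans b) // ler_norm.
    - exact: finite_measure_integrable_cst.
  have SE x : (S k x)%:E = (\int[nu]_y (k (x, y))%:E)%E.
    rewrite /S /Rintegral fineK //.
    apply: integrable_fin_num => //.
    apply: (@le_integrable _ _ _ nu setT _ _ (EFin \o cst M)) => //.
    - exact/measurable_EFinP.
    - move=> y _ /=; rewrite lee_fin ger0_norm //.
      by case/andP: (kM (x, y)) => a b; rewrite (le_trans b) // ler_norm.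
    - exact: finite_measure_integrable_cst.
  split=> //.
    apply/measurable_EFinP; rewrite (_ : _ \o _ = fubini_F nu (EFin \o k)); last first.
      by apply/funext => x; exact: SE.
    by apply: measurable_fun_fubini_tonelli_F => //; exact/measurable_EFinP.
  rewrite /Rintegral; congr fine.
  rewrite (eq_measure_integral (mu \x nu)%E); last first.
    by move=> A mA _; apply/esym/product_measure_unique.
  rewrite fubini_tonelli1 //; last exact/measurable_EFinP.
  by apply: eq_integral => x _; rewrite SE.
have [mSf Sf0 ->] := P f mf fM; have [mSg Sg0 ->] := P g mg gM; have [mSh Sh0 ->] := P h mh hM.
apply: (PL1 _ _ _ M) => // x y.
apply: (PL2 _ _ _ M) => //.
- exact: measurableT_comp mf (pair1_measurable x).
- exact: measurableT_comp mg (pair1_measurable y).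
- exact: measurableT_comp mh (pair1_measurable _).
Qed.

(** Events of the families not yet merged in the induction of [pl_factor_independent]: one event
    from each of the families [j] to [n - 1], where [setT] stands for no constraint. *)
Definition tail_events (T : Type) (F : nat -> set (set T)) (n j : nat) (E : set T) : Prop :=
  exists2 B : nat -> set T, (forall k, (j <= k < n)%N -> F k (B k)) &
    E = \bigcap_(k in [set k | (j <= k < n)%N]) B k.

Lemma tail_events_setI (T : Type) (F : nat -> set (set T)) n j (B E : set T) :
  (j < n)%N -> F j B -> tail_events F n j.+1 E -> tail_events F n j (B `&` E).
Proof.
move=> jn FB [C FC ->]; exists (fun k => if k == j then B else C k).
  move=> k /andP[jk kn]; case: eqVneq => [->//|kj].
  by apply: FC; rewrite kn ltn_neqAle eq_sym kj jk.
apply/seteqP; split=> [x [Bx Cx] k /= /andP[jk kn]|x BCx].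
  case: eqVneq => // kj; apply: Cx => /=.
  by rewrite kn ltn_neqAle eq_sym kj jk.
split; first by have := BCx j; rewrite /= leqnn jn eqxx; apply.
move=> k /= /andP[jk kn]; have := BCx k.
by rewrite /= kn (ltnW jk) gtn_eqF //; apply.
Qed.

Lemma tail_events_setT (T : Type) (F : nat -> set (set T)) n j :
  (forall k, (k < n)%N -> F k setT) -> tail_events F n j setT.
Proof.
move=> FT; exists (fun=> setT); first by move=> k /andP[_ /FT].
by apply/seteqP; split.
Qed.

Lemma tail_events_measurable d (T : measurableType d) (F : nat -> set (set T)) n j E :
  (forall k, (k < n)%N -> F k `<=` measurable) -> tail_events F n j E -> measurable E.
Proof.
move=> Fm [B FB ->]; apply: bigcap_measurableType => k /= /andP[jk kn].
by apply: (Fm k kn); apply: FB; rewrite jk.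
Qed.

(** Both sides are finite measures in [C] that agree on rectangles, a generating pi-system. *)
Lemma independent_pair_event (R : realType) d d1 d2 (Omega : measurableType d)
    (P : probability Omega R) (T1 : measurableType d1) (T2 : measurableType d2)
    (Y : Omega -> T1) (X : Omega -> T2) (E : set Omega) :
  measurable_fun setT Y -> measurable_fun setT X -> measurable E ->
  (forall A B, measurable A -> measurable B ->
     P (Y @^-1` A `&` X @^-1` B `&` E) = P (Y @^-1` A `&` X @^-1` B) * P E)%E ->
  forall C, measurable C ->
    P ((fun w => (Y w, X w)) @^-1` C `&` E) = (P ((fun w => (Y w, X w)) @^-1` C) * P E)%E.
Proof.
move=> mY mX mE rect C mC; pose Z w := (Y w, X w).
have mZ : measurable_fun setT Z by exact: measurable_fun_pair.
have PE0 : 0 <= fine (P E) by rewrite fine_ge0.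
pose m1 := (pushforward (mrestr P mE) Z : {measure set (T1 * T2) -> \bar R}).
pose m2 := mscale (NngNum PE0) (pushforward P Z).
rewrite muleC.
suff : m1 mZ C = m2 mZ C.
  by rewrite /m1 /m2 /= /pushforward /mrestr /mscale /= fineK ?fin_num_measure.
pose G := [set A `*` B | A in @measurable _ T1 & B in @measurable _ T2].
apply: (@measure_unique _ R _ G (fun=> setT)) => //.
- exact: measurable_prod_measurableType.
- move=> _ _ [A mA [B mB <-]] [A' mA' [B' mB' <-]].
  exists (A `&` A'); first exact: measurableI.
  by exists (B `&` B'); [exact: measurableI|rewrite setXI].
- by move=> _; exists setT => //; exists setT => //; rewrite setXTT.
- by rewrite bigcup_const //; exists 0%N.
- move=> _ [A mA [B mB <-]].
  by rewrite /m1 /m2 /= /pushforward /mrestr /mscale /= fineK ?fin_num_measure // muleC -rect.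
- move=> _; rewrite /m1 /= /pushforward /mrestr setTI.
  by rewrite ltey_eq fin_num_measure.
Qed.

(** The product formula is used for the indices above [j] and for the same indices with [j] added;
    the two products differ by the factor [P B]. *)
Lemma mutually_independent_tail (R : realType) d (Omega : measurableType d)
    (P : probability Omega R) (n : nat) (F : nat -> set (set Omega)) :
  mutually_independent P (fun i : 'I_n => F i) ->
  forall j B E, (j < n)%N -> F j B -> tail_events F n j.+1 E ->
    (P (B `&` E) = P B * P E)%E.
Proof.
move=> indep j B _ jn FB [C FC ->].
pose D k := if k == j then B else C k.
pose J : {set 'I_n} := [set i | (j < nat_of_ord i)%N]%SET; pose j' := Ordinal jn.
have FD (i : 'I_n) : i \in j' |: J -> F i (D i).
  rewrite !inE /D => /orP[/eqP->|ji]; first by rewrite /= eqxx.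
  by rewrite gtn_eqF //; apply: FC; rewrite ji ltn_ord.
have IJ (K : {set 'I_n}) : K \subset j' |: J ->
    P (\bigcap_(i in [set` K]) D i) = (\prod_(i in K) P (D i))%E.
  move=> /fintype.subsetP KJ.
  by apply: (indep K (fun i : 'I_n => D i)) => i /KJ; exact: FD.
have -> : B `&` \bigcap_(k in [set k | (j < k < n)%N]) C k =
    \bigcap_(i in [set` j' |: J]) D i.
  apply/seteqP; split=> [w [Bw Cw] i /=|w Dw].
    rewrite !inE /D => /orP[/eqP->|ji]; first by rewrite /= eqxx.
    by rewrite gtn_eqF //; apply: Cw; rewrite /= ji ltn_ord.
  have DE k (kn : (k < n)%N) : (j <= k)%N -> D k w.
    by move=> jk; apply: (Dw (Ordinal kn)); rewrite /= !inE -val_eqE /= eq_sym -leq_eqVlt.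
  split; first by have := DE j jn (leqnn j); rewrite /D eqxx.
  by move=> k /= /andP[jk kn]; have := DE k kn (ltnW jk); rewrite /D gtn_eqF.
have -> : \bigcap_(k in [set k | (j < k < n)%N]) C k = \bigcap_(i in [set` J]) D i.
  apply/seteqP; split=> [w Cw i /=|w Dw k /= /andP[jk kn]].
    by rewrite !inE /D => ji; rewrite gtn_eqF //; apply: Cw; rewrite /= ji ltn_ord.
  have : D k w by apply: (Dw (Ordinal kn)); rewrite /= inE.
  by rewrite /D gtn_eqF.
rewrite !IJ //; last exact: finset.subsetUr.
by rewrite big_setU1 ?inE ?ltnn //= /D eqxx.
Qed.

(* [Omega] carries no interpolation map, so the inequality lives on the space of
   values of a [G]-measurable random element; only real functions that are affine
   in it ([affine_in]) are transported further. *)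
Record pl_factor (R : realType) (theta : R) d (Omega : measurableType d)
    (P : probability Omega R) (G : set (set Omega)) := PLFactor {
  pl_disp : measure_display;
  pl_space : measurableType pl_disp;
  pl_map : Omega -> pl_space;
  pl_mid : pl_space -> pl_space -> pl_space;
  pl_law : probability pl_space R;
  pl_event : forall A, measurable A -> G (pl_map @^-1` A);
  pl_lawE : forall A, measurable A -> pl_law A = P (pl_map @^-1` A);
  pl_lawP : prekopa_leindler theta pl_law pl_mid
}.

Definition affine_in (R : realType) (theta : R) d (Omega : measurableType d)
    (P : probability Omega R) (G : set (set Omega)) (f : pl_factor theta P G)
    (Z : Omega -> R) : Prop :=
  exists pi : pl_space f -> R,
    [/\ measurable_fun setT pi, forall w, pi (pl_map f w) = Z w &
        forall x y, pi (pl_mid x y) = theta * pi x + (1 - theta) * pi y].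

(** The first [j] factors are merged into one product space by induction on [j]. Independence of the
    merged map from the later families is part of the invariant, since it identifies the joint law
    with the next factor as a product. Measurability for the generated sigma-algebra is kept as
    well: it lets the lemma be applied a second time, with whole motions as factors. The projections
    intertwine the interpolation maps, which keeps affine functions affine. *)
Lemma pl_factor_independent (R : realType) (theta : R) d (Omega : measurableType d)
    (P : probability Omega R) (n : nat) (F : nat -> set (set Omega))
    (f : forall k, pl_factor theta P (F k)) :
  (forall k, F k `<=` measurable) ->
  mutually_independent P (fun i : 'I_n => F i) ->
  exists g : pl_factor theta P <<s \bigcup_k F k >>,
    forall k Z, (k < n)%N -> affine_in (f k) Z -> affine_in g Z.
Proof.
move=> Fm /mutually_independent_tail FI.
pose T k := pl_space (f k); pose X k := @pl_map _ _ _ _ _ _ (f k).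
pose mid k := @pl_mid _ _ _ _ _ _ (f k); pose law k := pl_law (f k).
have FX k A : measurable A -> F k (X k @^-1` A) by exact: pl_event.
have lawE k A : measurable A -> law k A = P (X k @^-1` A) by exact: pl_lawE.
have PL k : prekopa_leindler theta (law k) (@mid k) by exact: pl_lawP.
have mX k : measurable_fun setT (X k).
  by move=> _ A mA; rewrite setTI; apply: Fm; exact: FX.
have FT k : F k setT by rewrite -(preimage_setT (X k)); exact: FX.
pose H := \bigcup_k F k.
suff : forall j, (j <= n)%N -> exists d' (S : measurableType d') (Y : Omega -> S)
      (m : S -> S -> S) (nu : probability S R),
    [/\ measurable_fun setT Y,
        measurable_fun setT (Y : g_sigma_algebraType H -> S),
        (forall A, measurable A -> nu A = P (Y @^-1` A)) /\
        prekopa_leindler theta nu m,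
        forall A E, measurable A -> tail_events F n j E ->
          (P (Y @^-1` A `&` E) = P (Y @^-1` A) * P E)%E &
        forall k, (k < j)%N -> exists pi : S -> T k,
          [/\ measurable_fun setT pi, forall w, pi (Y w) = X k w &
              forall x y, pi (m x y) = mid k (pi x) (pi y)]].
  move=> /(_ n (leqnn n))[d' [S [Y [m [nu [mY mYH [nuE PLn] _ piE]]]]]].
  have YH A : measurable A -> <<s H >> (Y @^-1` A).
    by move=> mA; have := mYH measurableT A mA; rewrite setTI.
  exists (PLFactor YH nuE PLn) => k Z kn [q [mq qX qm]].
  have [p [mp pY pm]] := piE k kn; exists (q \o p); split => /=.
  - exact: measurableT_comp.
  - by move=> w; rewrite pY qX.
  - by move=> x y; rewrite pm qm.
elim=> [_|j IH jn].
  exists _, unit, (fun=> tt), (fun _ _ => tt), \d_tt.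
  split=> //.
  - split; last by apply: (@prekopa_leindler_dirac _ _ _ _ tt).
    move=> A mA; rewrite -[LHS]/((\1_A tt)%:E) indicE; case: (boolP (tt \in A)) => [|] h.
      rewrite (_ : _ @^-1` A = setT) ?probability_setT //.
      by apply/seteqP; split => // w _ /=; rewrite inE in h.
    rewrite (_ : _ @^-1` A = set0) ?measure0 //.
    by apply/seteqP; split => // w /= Aw; move: h; rewrite notin_setE.
  - move=> A E mA _; case: (pselect (A tt)) => h.
      rewrite (_ : _ @^-1` A = setT) ?probability_setT ?setTI ?mul1e //.
      by apply/seteqP; split.
    rewrite (_ : _ @^-1` A = set0) ?set0I ?measure0 ?mul0e //.
    by apply/seteqP; split.
have [d' [S [Y [m [nu [mY mYH [nuE PLn] YI piE]]]]]] := IH (ltnW jn).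
pose Z w := (Y w, X j w).
have mZ : measurable_fun setT Z by exact: measurable_fun_pair.
pose ZM : {mfun Omega >-> (S * T j)%type} := HB.pack Z (isMeasurableFun.Build _ _ _ _ _ mZ).
exists _, (S * T j)%type, Z, (fun x y => (m x.1 y.1, mid j x.2 y.2)), (distribution P ZM).
split=> //.
- apply: measurable_fun_pair => //.
  move=> _ A mA; rewrite setTI; apply: sub_sigma_algebra.
  by exists j => //; exact: FX.
- split=> //.
  apply: (@prekopa_leindler_prod _ _ _ _ _ _ nu (law j)) => //.
  move=> A B mA mB; rewrite nuE // lawE //.
  transitivity (P (Y @^-1` A `&` X j @^-1` B)) => //.
  apply: YI => //; rewrite -[X j @^-1` B]setIT.
  by apply: tail_events_setI => //; [exact: FX|exact: tail_events_setT].
- move=> A E mA tE; apply: independent_pair_event => //.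
  + by apply: tail_events_measurable tE => k _; exact: Fm.
  + move=> B C mB mC; rewrite -setIA YI //; last first.
      by apply: tail_events_setI => //; exact: FX.
    rewrite (FI j _ E jn) //; last exact: FX.
    rewrite muleA; congr (_ * _)%E; apply/esym/YI => //.
    rewrite -[X j @^-1` C]setIT.
    by apply: tail_events_setI => //; [exact: FX|exact: tail_events_setT].
- move=> k; rewrite ltnS leq_eqVlt => /predU1P[->|kj].
    by exists snd; split=> //; exact: measurable_snd.
  have [p [mp pY pm]] := piE k kj.
  exists (p \o fst); split=> //.
  + exact: measurableT_comp.
  + by move=> x y /=; rewrite pm.
Qed.

Lemma pl_factor_sub (R : realType) (theta : R) d (Omega : measurableType d)
    (P : probability Omega R) (G G' : set (set Omega)) (g : pl_factor theta P G) :
  G `<=` G' -> exists g' : pl_factor theta P G', forall Z, affine_in g Z -> affine_in g' Z.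
Proof.
move=> GG'; case: g => d' S Y m nu YG nuE PL.
by exists (PLFactor (fun A mA => GG' _ (YG A mA)) nuE PL).
Qed.

(** * Marginals of the free and bridge measures *)

(** Since [tau 0 = a] and [W a = 0], each [W (tau k)] is a sum of independent increments, hence
    affine in their product. The grid may repeat times, which makes some increments point masses at
    0. *)
Lemma brownian_pl_factor (R : realType) (theta : R) d (Omega : measurableType d)
    (P : probability Omega R) (a b : R) (W : R -> Omega -> R) (tau : nat -> R) (n : nat) :
  0 < theta < 1 -> brownian P a b W ->
  {homo tau : i j / (i <= j)%N >-> i <= j} -> (forall i, tau i \in `[a, b]) ->
  tau 0%N = a ->
  exists g : pl_factor theta P (process_sigma a b W),
    forall k, (k <= n)%N -> affine_in g (W (tau k)).
Proof.
move=> t01 [mW W0 _ Wn Wi] tau_le tau_ab tau0.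
have mWt i : measurable_fun setT (W (tau i)) by exact: mW.
pose X (k : nat) w := W (tau k.+1) w - W (tau k) w.
have mX k : measurable_fun setT (X k) by exact: measurable_funB.
pose XM k : {mfun Omega >-> R} := HB.pack (X k) (isMeasurableFun.Build _ _ _ _ _ (mX k)).
pose F k := preimage_set_system setT (X k) measurable.
have Fm k : F k `<=` measurable.
  by move=> _ [A mA <-]; exact: (mX k).
have FX k A : measurable A -> F k (X k @^-1` A).
  by move=> mA; exists A => //; rewrite setTI.
have PL k : prekopa_leindler theta (distribution P (XM k))
    (fun x y => theta * x + (1 - theta) * y).
  have [lt|ge] := ltP (tau k) (tau k.+1).
    have s0 : Num.sqrt (tau k.+1 - tau k) != 0 by rewrite gt_eqF // sqrtr_gt0 subr_gt0.
    apply: prekopa_leindler_pushforward (prekopa_leindler_normal t01 s0) => //.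
      exact: measurable_id.
    move=> A mA; apply: (Wn (tau k) (tau k.+1)) => //.
      by have := tau_ab k; rewrite in_itv => /andP[].
      by have := tau_ab k.+1; rewrite in_itv => /andP[].
    by [].
  apply: (@prekopa_leindler_dirac R theta _ R 0); last by rewrite !mulr0 addr0.
  move=> A mA; have E : tau k.+1 = tau k.
    by apply/eqP; rewrite eq_le ge tau_le.
  rewrite diracE -[LHS]/(P (X k @^-1` A)).
  have X0 w : X k w = 0 by rewrite /X E subrr.
  case: (boolP (0 \in A)) => [|] h.
    rewrite (_ : _ @^-1` A = setT) ?probability_setT //.
    by apply/seteqP; split => // w _ /=; rewrite X0; rewrite inE in h.
  rewrite (_ : _ @^-1` A = set0) ?measure0 //.
  by apply/seteqP; split => // w /=; rewrite X0 => Aw; move: h; rewrite notin_setE.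
have lawE k A : measurable A -> distribution P (XM k) A = P (X k @^-1` A) by [].
pose f k := PLFactor (FX k) (lawE k) (PL k).
have [g gP] := pl_factor_independent f Fm (Wi n tau tau_le tau_ab).
have sub : <<s \bigcup_k F k >> `<=` process_sigma a b W.
  apply: smallest_sub; first exact: smallest_sigma_algebra.
  move=> _ [k _ [B mB <-]]; rewrite setTI.
  have mWs i : measurable_fun setT (W (tau i) : g_sigma_algebraType
      (\bigcup_(t in `[a, b]) preimage_set_system setT (W t) measurable) -> R).
    move=> _ C mC; rewrite setTI; apply: sub_sigma_algebra.
    by exists (tau i); [exact: tau_ab|exists C => //; rewrite setTI].
  have := measurable_funB (mWs k.+1) (mWs k) measurableT mB.
  by rewrite setTI.
have [g' g'P] := pl_factor_sub g sub.
exists g'; elim=> [_|k IH kn].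
  exists (fun=> 0); split=> //.
  + by move=> w; rewrite tau0 W0.
  + by move=> x y; rewrite !mulr0 addr0.
have [p [mp pY pm]] := IH (ltnW kn).
have fX : affine_in (f k) (X k) by exists idfun; split => //; exact: measurable_id.
have [q [mq qY qm]] := g'P _ (gP k (X k) kn fX).
exists (fun s => q s + p s); split.
- exact: measurable_funD.
- by move=> w; rewrite pY qY /X subrK.
- by move=> x y; rewrite pm qm; ring.
Qed.

Lemma independent_brownian_pl_factor (R : realType) (theta : R) d (Omega : measurableType d)
    (P : probability Omega R) (a b : R) (m : nat) (B : 'I_m.+1 -> R -> Omega -> R)
    (tau : nat -> R) (n : nat) :
  0 < theta < 1 -> independent_brownian P a b B ->
  {homo tau : i j / (i <= j)%N >-> i <= j} -> (forall i, tau i \in `[a, b]) ->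
  tau 0%N = a ->
  exists g : pl_factor theta P measurable,
    forall i k, (k <= n)%N -> affine_in g (B i (tau k)).
Proof.
move=> t01 [bB indB] tau_le tau_ab tau0.
(* Families are indexed by [nat] through [inord]; the values at indices beyond [m] are arbitrary, as
   independence and the projections concern only the first [m.+1] of them. *)
pose F k := process_sigma a b (B (inord k)).
have Fm k : F k `<=` measurable.
  apply: smallest_sub; first exact: sigma_algebra_measurable.
  move=> _ [t tab [A mA <-]]; case: (bB (inord k)) => mW _ _ _ _.
  by apply: mW.
have indF : mutually_independent P (fun i : 'I_m.+1 => F i).
  by rewrite (_ : (fun i => _) = fun i => process_sigma a b (B i)) //;
    apply/funext => i; rewrite /F inord_val.
pose h k := cid (brownian_pl_factor n t01 (bB (inord k)) tau_le tau_ab tau0).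
pose f k := projT1 (h k).
have [g gP] := pl_factor_independent f Fm indF.
have sub : <<s \bigcup_k F k >> `<=` measurable.
  apply: smallest_sub; first exact: sigma_algebra_measurable.
  by move=> A [k _]; exact: Fm.
have [g' g'P] := pl_factor_sub g sub.
exists g' => i k kn; have := g'P _ (gP i _ (ltn_ord i) (projT2 (h i) k kn)).
by rewrite inord_val.
Qed.

(** The shape common to both cases: a motion at time [t], a multiple of its value at [b], which is 0
    in the free case, and a deterministic drift. *)
Lemma affine_in_comb (R : realType) (theta c e : R) d (Omega : measurableType d)
    (P : probability Omega R) (G : set (set Omega)) (g : pl_factor theta P G)
    (Z1 Z2 : Omega -> R) :
  affine_in g Z1 -> affine_in g Z2 -> affine_in g (fun w => Z1 w + c * Z2 w + e).
Proof.
move=> [p1 [mp1 pY1 pm1]] [p2 [mp2 pY2 pm2]].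
exists (fun s => p1 s + c * p2 s + e); split.
- apply: measurable_funD => //; apply: measurable_funD => //.
  exact: measurable_funM.
- by move=> w; rewrite pY1 pY2.
- by move=> x y; rewrite pm1 pm2; ring.
Qed.

(** An open set is the union of the rational boxes it contains, of which there are countably
    many. *)
Lemma measurable_rV (R : realType) d (T : measurableType d) n (g : T -> 'rV[R]_n) :
  (forall i, measurable_fun setT (fun w => g w 0 i)) ->
  measurable_fun setT (g : T -> borel 'rV[R]_n).
Proof.
move=> mg.
apply: (@measurability _ _ T (borel 'rV[R]_n) setT g (@open 'rV[R]_n)) => //.
move=> _ [U oU <-]; rewrite setTI.
pose box (q : {ffun 'I_n -> rat * rat}) : set 'rV[R]_n :=
  [set v | forall i, ratr (q i).1 < v 0 i < ratr (q i).2].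
have -> : g @^-1` U = \bigcup_(q in [set q | box q `<=` U]) g @^-1` box q.
  apply/seteqP; split => [w Uw|w [q qU /qU]//].
  have /nbhs_ballP[e /= e0 eU] := open_nbhs_nbhs (conj oU Uw).
  have lt1 i : g w 0 i - e < g w 0 i by rewrite gtrDl oppr_lt0.
  have lt2 i : g w 0 i < g w 0 i + e by rewrite ltrDl.
  pose q := [ffun i => (sval (cid (rat_in_itvoo (lt1 i))), sval (cid (rat_in_itvoo (lt2 i))))].
  have qP i : g w 0 i - e < ratr (q i).1 < g w 0 i /\ g w 0 i < ratr (q i).2 < g w 0 i + e.
    rewrite ffunE /=; split.
      by case: cid => /= x; rewrite in_itv.
    by case: cid => /= x; rewrite in_itv.
  exists q => /=; last by move=> i; have [/andP[_ ->] /andP[-> _]] := qP i.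
  move=> v qv; apply: eU; split => // k i; rewrite ord1 /ball /= ltr_norml.
  have [/andP[h1 h2] /andP[h3 h4]] := qP i; have /andP[h5 h6] := qv i.
  by apply/andP; split; lra.
rewrite bigcup_mkcond; apply: countable_bigcupT_measurable; first exact: countableP.
move=> q; case: ifP => // _.
rewrite (_ : g @^-1` box q =
    \bigcap_(i in setT) [set w | ratr (q i).1 < g w 0 i < ratr (q i).2]); last first.
  by apply/seteqP; split => [w /= gw i _|w /= gw i]; [exact: gw|exact: gw].
apply: fin_bigcap_measurable => [|i _]; first exact: finite_finset.
rewrite (_ : [set w | _] = (fun w => g w 0 i) @^-1` `]ratr (q i).1, ratr (q i).2[); last first.
  by apply/seteqP; split => w /=; rewrite in_itv.
by rewrite -[X in measurable X]setTI; exact: mg.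
Qed.

Lemma lineE (R : realType) (r : rectangle R) (z : cfun (dom r)) (q : dom r) :
  exists i : 'I_(width r), val q = (site i, (val q).2) /\ z q = line z i (val q).2.
Proof.
have [] := set_valP q; rewrite /= in_itv /=.
set j : int := (sval q).1 => /andP[lj jh] _.
have lt : (`|j - lo r| < width r)%N by rewrite /width ltnS; lia.
have jE : j = site (Ordinal lt) by rewrite /site /=; lia.
have E : sval q = (site (Ordinal lt), (sval q).2) by rewrite -jE /j; case: (sval q).
exists (Ordinal lt); split => //; rewrite /line -E.
by have /(congr1 (fun f => f q)) := valLK 0 (z : dom r -> R); rewrite /sigL.
Qed.

(** The affine functions of the factor, gathered into a row vector, form a map that takes [pl_mid]
    to convex combinations, so the inequality passes to its image law. *)
Lemma prekopa_leindler_law (R : realType) (theta : R) (r : rectangle R) d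
    (Omega : measurableType d) (P : probability Omega R)
    (Y : 'I_(width r) -> R -> Omega -> R)
    (gamma : probability (borel (cfun (dom r))) R) N (q : 'I_N -> dom r) :
  law_of P Y gamma ->
  (exists g : pl_factor theta P measurable, forall i k, affine_in g (Y i (val (q k)).2)) ->
  prekopa_leindler theta (distribution gamma (eval_at q))
    (fun x y => theta *: x + (1 - theta) *: y).
Proof.
move=> [X [XY gammaE]] [g gP].
(* The line through [q k] must not depend on the random function, so it is chosen with the arbitrary
   function [point]; injectivity of [site] later identifies it with the line found for [X w]. *)
have [i iP] := choice (fun k => lineE point (q k)).
have gP' k := gP (i k) k.
pose p k := sval (cid (gP' k)).
have pP k : [/\ measurable_fun setT (p k),
   forall w, p k (pl_map g w) = Y (i k) (val (q k)).2 w &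
   forall x y, p k (pl_mid x y) = theta * p k x + (1 - theta) * p k y].
  by rewrite /p; case: cid.
pose phi (s : pl_space g) : borel 'rV[R]_N := \row_k p k s.
apply: (@prekopa_leindler_pushforward _ _ _ _ (pl_space g) _ phi (pl_law g) _ (@pl_mid _ _ _ _ _ _ g)).
- apply: measurable_rV => k.
  by under eq_fun do rewrite mxE; case: (pP k).
- move=> A mA; rewrite [LHS]gammaE; last first.
    by rewrite -[X in measurable X]setTI; exact: measurable_funP.
  rewrite [RHS](_ : _ = P (pl_map g @^-1` (phi @^-1` A))); last first.
    apply: pl_lawE; have mphi : measurable_fun setT (phi : pl_space g -> borel 'rV[R]_N).
      by apply: measurable_rV => k; under eq_fun do rewrite mxE; case: (pP k).
    by rewrite -[X in measurable X]setTI; exact: mphi.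
  congr (P _); apply/seteqP.
  suff E w : eval_at q (X w) = phi (pl_map g w) by split => w /=; rewrite E.
  apply/rowP => k; rewrite !mxE.
  have [_ -> _] := pP k; rewrite -XY; last by have [_] := set_valP (q k).
  have [i' [E ->]] := lineE (X w) (q k).
  have [E' _] := iP k.
  by move: (etrans (esym (congr1 fst E)) (congr1 fst E')) => /addrI[] /val_inj ->.
- move=> x y; apply/rowP => k; rewrite !mxE.
  by have [_ _ ->] := pP k.
- exact: pl_lawP.
Qed.

Lemma exists_grid (R : realType) (a b : R) (s : seq R) : a <= b ->
  all (fun t => t \in `[a, b]) s ->
  exists tau : nat -> R, [/\ {homo tau : i j / (i <= j)%N >-> i <= j},
    forall i, tau i \in `[a, b], tau 0%N = a &
    exists n, forall t, t \in s -> exists2 k, (k <= n)%N & tau k = t].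
Proof.
move=> ab /allP sab.
(* Beyond the end of the list the default [b] keeps the grid monotone and inside [[a, b]]. *)
pose l := a :: sort <=%R s; pose tau i := nth b l i.
have lab t : t \in l -> t \in `[a, b].
  rewrite inE mem_sort => /predU1P[->|]; last exact: sab.
  by rewrite in_itv /= lexx.
have tau_ab i : tau i \in `[a, b].
  have [il|li] := ltnP i (size l); first by apply: lab; exact: mem_nth.
  by rewrite /tau nth_default // in_itv /= ab lexx.
have l_sorted : sorted <=%R l.
  have ss : sorted <=%R (sort <=%R s) by apply: sort_sorted; exact: le_total.
  rewrite /l /= path_min_sorted //.
  by apply/allP => t; rewrite mem_sort => /sab; rewrite in_itv => /andP[].
exists tau; split => //.
- move=> i j ij; have [jl|lj] := ltnP j (size l).
    apply: (sorted_leq_nth le_trans le_refl) => //.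
    by rewrite inE (leq_ltn_trans ij).
  rewrite [tau j]nth_default //.
  by have := tau_ab i; rewrite in_itv => /andP[].
- exists (size l) => t ts; exists (index t l); last first.
    by rewrite /tau nth_index // inE mem_sort ts orbT.
  exact: index_size.
Qed.

Lemma prekopa_leindler_gaussian (R : realType) (theta : R) (r : rectangle R)
    (gamma : probability (borel (cfun (dom r))) R) N (q : 'I_N -> dom r) :
  0 < theta < 1 ->
  (exists x eta, C0 eta /\ free_law x eta gamma) \/
  (exists x y eta, C00 eta /\ bridge_law x y eta gamma) ->
  prekopa_leindler theta (distribution gamma (eval_at q))
    (fun x y => theta *: x + (1 - theta) *: y).
Proof.
move=> t01 gammaP; set a := left_end r; set b := right_end r.
have ab : a <= b by rewrite ltW // left_lt_right.
have qab k : (val (q k)).2 \in `[a, b] by have [_] := set_valP (q k).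
(* The time [b] is added to the evaluation times because a bridge subtracts a multiple of the value
   of the motion at [b]. *)
have [] := @exists_grid R a b (b :: [seq (val (q k)).2 | k <- enum 'I_N]) ab.
  rewrite /= in_itv /= ab lexx /=; apply/allP => _ /mapP[k _ ->]; exact: qab.
move=> tau [tau_le tau_ab tau0 [n tauP]].
have fac d (Omega : measurableType d) (P : probability Omega R)
    (B : 'I_(width r) -> R -> Omega -> R) : independent_brownian P a b B ->
    exists g : pl_factor theta P measurable,
      forall i t, t \in b :: [seq (val (q k)).2 | k <- enum 'I_N] -> affine_in g (B i t).
  move=> iB.
  have [g gP] := independent_brownian_pl_factor n t01 iB tau_le tau_ab tau0.
  by exists g => i t /tauP[k kn <-]; exact: gP.
have facq d (Omega : measurableType d) (P : probability Omega R)
    (B : 'I_(width r) -> R -> Omega -> R) (c : 'I_(width r) -> R -> R)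
    (e : 'I_(width r) -> R -> R) : independent_brownian P a b B ->
    exists g : pl_factor theta P measurable, forall i k, let t := (val (q k)).2 in
      affine_in g (fun w => B i t w + c i t * B i b w + e i t).
  move=> /fac[g gP]; exists g => i k /=; apply: affine_in_comb; apply: gP; last first.
    by rewrite inE eqxx.
  by rewrite inE; apply/orP; right; apply/mapP; exists k => //; rewrite mem_enum.
case: gammaP.
  case=> x; case=> h; case=> _; case=> d; case=> Omega; case=> P; case=> B; case=> iB gammaL.
  apply: (prekopa_leindler_law gammaL).
  have [g gP] := facq _ _ _ _ (fun _ _ => 0) (fun i t => x 0 i + line h i t) iB.
  exists g => i k; have := gP i k; congr affine_in; apply/funext => w /=; ring.
case=> x; case=> y; case=> h; case=> _; case=> d; case=> Omega; case=> P; case=> B; case=> iB gammaL.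
apply: (prekopa_leindler_law gammaL).
have [g gP] := facq _ _ _ _ (fun _ t => - ((t - a) / (b - a)))
  (fun i t => ((b - t) * x 0 i + (t - a) * y 0 i) / (b - a) + line h i t) iB.
exists g => i k; have := gP i k; congr affine_in; apply/funext => w /=.
by rewrite /bridge -/a -/b; ring.
Qed.

(** Here the target [R] carries its own sigma-algebra and not [borel R]; open intervals serve as
    generators. *)
Lemma continuous_borel_real (R : realType) (T : ptopologicalType) (f : T -> R) :
  continuous f -> measurable_fun setT (f : borel T -> R).
Proof.
move=> /continuousP cf.
apply: (measurability _ (RGenOpens.measurableE R)).
move=> _ [_ [a [b ->]] <-]; rewrite setTI; apply: sub_sigma_algebra.
by apply: cf; exact: interval_open.
Qed.

(** * Weak limits *)

Lemma open_borel (T : ptopologicalType) (U : set T) :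
  open U -> measurable (U : set (borel T)).
Proof. exact: sub_sigma_algebra. Qed.

Lemma closed_borel (T : ptopologicalType) (U : set T) :
  closed U -> measurable (U : set (borel T)).
Proof.
move=> cU; rewrite -(setCK U); apply: measurableC; apply: open_borel.
exact: closed_openC.
Qed.

Lemma powR_cvg (R : realType) (u : nat -> R) (a p : R) : 0 < a ->
  u n @[n --> \oo] --> a -> (u n `^ p) @[n --> \oo] --> a `^ p.
Proof.
move=> a0 ua; apply: (cvg_comp u (fun x : R => x `^ p) ua).
have /derivable1_diffP/differentiable_continuous : derivable (fun x : R => x `^ p) a 1.
  by apply: derivable_powR; rewrite in_itv /= a0.
exact.
Qed.

(** Continuity of powers is used at positive limits only: a vanishing limit makes the left side
    0. *)
Lemma powR_le_lim (R : realType) (theta a b c : R) (u v w : nat -> R) :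
  0 < theta < 1 -> 0 <= a -> 0 <= b -> 0 <= c ->
  u n @[n --> \oo] --> a -> v n @[n --> \oo] --> b -> w n @[n --> \oo] --> c ->
  (forall n, u n `^ theta * v n `^ (1 - theta) <= w n) ->
  a `^ theta * b `^ (1 - theta) <= c.
Proof.
move=> /andP[t0 t1]; rewrite le_eqVlt => /predU1P[<-|a0].
  by rewrite powR0 ?mul0r // gt_eqF.
rewrite le_eqVlt => /predU1P[<-|b0].
  by rewrite [0 `^ _]powR0 ?mulr0 // gt_eqF // subr_gt0.
move=> c0 ua vb wc uvw.
have uv : (u n `^ theta * v n `^ (1 - theta)) @[n --> \oo] --> a `^ theta * b `^ (1 - theta).
  by apply: cvgM; exact: powR_cvg.
by apply: ler_cvg_to uv wc _; apply: nearW => n; exact: uvw.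
Qed.

Section distance_to_set.
Context (R : realType) (V : normedModType R) (A : set V).

Definition set_dist (x : V) : R := inf [set `|x - a| | a in A].

Context (A0 : A !=set0).

Let has_inf_dist x : has_inf [set `|x - a| | a in A].
Proof. split; first by case: A0 => a Aa; exists `|x - a|; exists a.
by exists 0 => _ [a _ <-].
Qed.

Lemma set_dist_le x a : A a -> set_dist x <= `|x - a|.
Proof. by move=> Aa; apply: ge_inf; [by exists 0 => _ [b _ <-]|exists a]. Qed.

Lemma set_dist_ge0 x : 0 <= set_dist x.
Proof. by apply: lb_le_inf; [case: (has_inf_dist x)|move=> _ [a _ <-]]. Qed.

Lemma set_dist_lt x e : set_dist x < e -> exists2 a, A a & `|x - a| < e.
Proof.
rewrite -subr_gt0 => /(inf_adherent)/(_ (has_inf_dist x))[_ [a Aa <-]].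
by rewrite subrKC => h; exists a.
Qed.

Lemma set_dist_lip x y : set_dist x <= `|x - y| + set_dist y.
Proof.
apply/ler_addgt0Pr => e e0.
have [a Aa ya] : exists2 a, A a & `|y - a| < set_dist y + e.
  by apply: set_dist_lt; rewrite ltrDl.
apply: le_trans (set_dist_le x Aa) _.
rewrite -addrA; apply: le_trans (_ : _ <= `|x - y| + `|y - a|) _; last by rewrite lerD2l ltW.
by rewrite -[X in `|X|](subrKA y) ler_normD.
Qed.

Lemma set_dist_continuous : continuous set_dist.
Proof.
move=> x; apply/cvgrPdist_lt => e e0.
have : \forall y \near x, `|x - y| < e by apply: cvgr_dist_lt => //; exact: cvg_id.
apply: filterS => y xy; rewrite ltr_norml; apply/andP; split.
  have := set_dist_lip y x; rewrite distrC => h; lra.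
by have := set_dist_lip x y; lra.
Qed.

Lemma set_dist0 x : closed A -> set_dist x = 0 -> A x.
Proof.
move=> cA dx; apply: cA => U /nbhs_ballP[e /= e0 eU].
have [a Aa xa] : exists2 a, A a & `|x - a| < e by apply: set_dist_lt; rewrite dx.
by exists a; split=> //; apply: eU; rewrite -ball_normE.
Qed.

(** Piecewise linear in the distance: 1 up to [(s - 1) * e] and 0 from [s * e] on. With [s = 1] it
    lies between the indicators of a set and of its [e]-neighbourhood, with [s = 2] between those of
    the [e]- and [2e]-neighbourhoods. *)
Definition cutoff (s e : R) (x : V) : R := Num.max 0 (Num.min 1 (s - set_dist x / e)).

Lemma cutoff_bound s e x : 0 <= cutoff s e x <= 1.
Proof. by rewrite /cutoff le_max lexx /= ge_max ler01 ge_min lexx. Qed.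

Lemma cutoff_continuous s e : continuous (cutoff s e).
Proof.
move=> x.
have c1 : {for x, continuous (fun y => s - set_dist y / e : R^o)}.
  apply: cvgB; first exact: cvg_cst.
  by apply: cvgMl; exact: set_dist_continuous.
have cc (c : R) : {for x, continuous (fun=> c : R^o)} by exact: cvg_cst.
exact: continuous_max (cc 0) (continuous_min (cc 1) c1).
Qed.

Lemma cutoff1 s e x : 0 < e -> set_dist x <= (s - 1) * e -> cutoff s e x = 1.
Proof.
move=> e0 h; rewrite /cutoff min_l; first by rewrite max_r.
have : set_dist x / e <= s - 1 by rewrite ler_pdivrMr.
by lra.
Qed.

Lemma cutoff0 s e x : 0 < e -> s * e <= set_dist x -> cutoff s e x = 0.
Proof.
move=> e0 h; rewrite /cutoff max_l // ge_min.
have : s <= set_dist x / e by rewrite ler_pdivlMr.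
by move=> h'; apply/orP; right; lra.
Qed.

End distance_to_set.

Lemma weak_limit_log_concave (R : realType) (n : nat)
    (mu : nat -> probability (borel 'rV[R]_n) R) (nu : probability (borel 'rV[R]_n) R) :
  (forall i (theta : R) (A B C : set (borel 'rV[R]_n)), 0 < theta < 1 ->
     measurable A -> measurable B -> measurable C ->
     (forall x y, A x -> B y -> C (theta *: (x : 'rV[R]_n) + (1 - theta) *: (y : 'rV[R]_n))) ->
     fine (mu i A) `^ theta * fine (mu i B) `^ (1 - theta) <= fine (mu i C)) ->
  weak_cvg mu nu -> log_concave nu.
Proof.
move=> mulc munu A B theta A0 cA B0 cB t01; have /andP[t0 t1] := t01.
have u0 : 0 < 1 - theta by rewrite subr_gt0.
pose V := 'rV[R]_n.
pose comb (z : V * V) : V := theta *: z.1 + (1 - theta) *: z.2.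
pose C := [set (theta *: x + (1 - theta) *: y)%R | x in A & y in B].
have CE : C = comb @` (A `*` B).
  apply/seteqP; split => [_ [x Ax [y By <-]]|_ [[x y] [Ax By] <-]].
    by exists (x, y).
  by exists x => //; exists y.
have C0 : C !=set0.
  case: A0 => x Ax; case: B0 => y By.
  by exists (theta *: x + (1 - theta) *: y); exists x => //; exists y.
have cC : compact C.
  rewrite CE; apply: continuous_compact; last exact: compact_setX.
  apply: continuous_subspaceT => z; apply: cvgD.
    by apply: cvgZr; exact: cvg_fst.
  by apply: cvgZr; exact: cvg_snd.
have clo (K : set V) : compact K -> closed K.
  by apply: compact_closed; exact: norm_hausdorff.
have mK (K : set V) : compact K -> measurable (K : set (borel V)).
  by move=> /clo; exact: closed_borel.
pose U (K : set V) (e : R) : set (borel V) := [set x | set_dist K x < e].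
have mU K e : K !=set0 -> measurable (U K e).
  move=> K0; apply: open_borel.
  have -> : U K e = set_dist K @^-1` `]-oo, e[%classic.
    by apply/seteqP; split => x; rewrite /= in_itv.
  have /continuousP := set_dist_continuous K0; apply.
  exact: interval_open.
pose E (m : probability (borel V) R) (phi : V -> R) := fine (\int[m]_x (phi x)%:E)%E.
pose cut (K : set V) s e : V -> R := cutoff K s e.
have cut0 K s e x : 0 <= cut K s e x by have /andP[] := cutoff_bound K s e x.
have mcut K s e : K !=set0 -> measurable_fun setT (cut K s e : borel V -> R).
  by move=> K0; apply: continuous_borel_real; exact: cutoff_continuous.
have Eint (m : probability (borel V) R) K s e : K !=set0 ->
    (0 <= \int[m]_x (cut K s e x)%:E <= 1)%E.
  move=> K0; rewrite integral_ge0 /=; last by move=> x _; rewrite lee_fin.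
  apply: (@le_trans _ _ (\int[m]_x (cst 1%E) x)%E).
    apply: ge0_le_integral => //=.
    - by move=> x _; rewrite lee_fin.
    - by apply/measurable_EFinP; exact: mcut.
    - by move=> x _; rewrite lee_fin; have /andP[] := cutoff_bound K s e x.
  by rewrite integral_cst //= mul1e probability_setT.
have Efin (m : probability (borel V) R) K s e : K !=set0 ->
    (\int[m]_x (cut K s e x)%:E)%E \is a fin_num.
  move=> /(Eint m K s e)/andP[h0 h1]; rewrite ge0_fin_numE //.
  by apply: le_lt_trans h1 _; rewrite ltry.
have E0 (m : probability (borel V) R) K s e : 0 <= E m (cut K s e).
  by rewrite /E fine_ge0 // integral_ge0 // => x _; rewrite lee_fin.
have Elow (m : probability (borel V) R) K s e (W : set (borel V)) : K !=set0 -> measurable W ->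
    (forall x, W x -> cut K s e x = 1) -> fine (m W) <= E m (cut K s e).
  move=> K0 mW W1; rewrite -lee_fin !fineK ?fin_num_measure ?Efin //.
  rewrite -[m W]mul1e -(setIT W) -integral_indic // ?mul1e.
  apply: ge0_le_integral => //=.
  - by apply/measurable_EFinP; exact: measurable_indic.
  - by apply/measurable_EFinP; exact: mcut.
  - move=> x _; rewrite lee_fin indicE; case: (boolP (x \in W)) => //.
    by rewrite inE => /W1 ->.
have Eupp (m : probability (borel V) R) K s e (W : set (borel V)) : K !=set0 -> measurable W ->
    (forall x, ~ W x -> cut K s e x = 0) -> E m (cut K s e) <= fine (m W).
  move=> K0 mW W1; rewrite -lee_fin !fineK ?fin_num_measure ?Efin //.
  rewrite -[m W]mul1e -(setIT W) -integral_indic // ?mul1e.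
  apply: ge0_le_integral => //=.
  - by move=> x _; rewrite lee_fin.
  - by apply/measurable_EFinP; exact: mcut.
  - by apply/measurable_EFinP; exact: measurable_indic.
  - move=> x _; rewrite lee_fin indicE; case: (boolP (x \in W)) => [_|].
      by have /andP[] := cutoff_bound K s e x.
    by rewrite notin_setE => /W1 ->.
have Ecvg K s e : K !=set0 -> E (mu i) (cut K s e) @[i --> \oo] --> E nu (cut K s e).
  move=> K0; apply: fine_cvg; rewrite fineK ?Efin //.
  apply: munu; first exact: cutoff_continuous.
  by exists 1 => z; rewrite ger0_norm //; have /andP[] := cutoff_bound K s e z.
have dist_self (K : set V) x : K x -> set_dist K x <= 0.
  by move=> Kx; have := set_dist_le x Kx; rewrite subrr normr0.
have pw x x' y y' : 0 <= x -> x <= x' -> 0 <= y -> y <= y' ->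
    x `^ theta * y `^ (1 - theta) <= x' `^ theta * y' `^ (1 - theta).
  move=> x0 xx y0 yy; apply: ler_pM; rewrite ?powR_ge0 //.
    by rewrite ge0_ler_powR ?nnegrE ?(ltW t0) // (le_trans x0).
  by rewrite ge0_ler_powR ?nnegrE ?(ltW u0) // (le_trans y0).
(* For each [i] the inequality holds for the open [e]-neighbourhoods. Cutoffs with [s = 1] bound
   those of [A] and [B] from below, a cutoff with [s = 2] bounds that of [C] from above, and only
   cutoffs are passed to the limit. *)
have main e : 0 < e -> fine (nu A) `^ theta * fine (nu B) `^ (1 - theta) <= fine (nu (U C (2 * e))).
  move=> e0.
  apply: (@le_trans _ _ (E nu (cut A 1 e) `^ theta * E nu (cut B 1 e) `^ (1 - theta))).
    apply: pw; rewrite ?E0 ?fine_ge0 //.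
      by apply: Elow => // [|x Ax]; [exact: mK|rewrite /cut cutoff1 // subrr mul0r; exact: (dist_self _ _ Ax)].
    by apply: Elow => // [|x Ax]; [exact: mK|rewrite /cut cutoff1 // subrr mul0r; exact: (dist_self _ _ Ax)].
  apply: (@le_trans _ _ (E nu (cut C 2 e))); last first.
    apply: Eupp => //; first exact: mU.
    by move=> x /negP; rewrite -leNgt => h; rewrite /cut cutoff0.
  apply: powR_le_lim (Ecvg A 1 e A0) (Ecvg B 1 e B0) (Ecvg C 2 e C0) _ => // i.
  apply: (@le_trans _ _ (fine (mu i (U A e)) `^ theta * fine (mu i (U B e)) `^ (1 - theta))).
    apply: pw; rewrite ?E0 ?fine_ge0 //.
      apply: Eupp => //; first exact: mU.
      by move=> x /negP; rewrite -leNgt => h; rewrite /cut cutoff0 // mul1r.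
    apply: Eupp => //; first exact: mU.
    by move=> x /negP; rewrite -leNgt => h; rewrite /cut cutoff0 // mul1r.
  apply: (@le_trans _ _ (fine (mu i (U C e)))); last first.
    apply: Elow => //; first exact: mU.
    by move=> x /ltW h; rewrite /cut cutoff1 //; lra.
  apply: (mulc i theta _ _ _ t01 (mU A e A0) (mU B e B0) (mU C e C0)).
  move=> x y /(set_dist_lt A0)[x' Ax' xx'] /(set_dist_lt B0)[y' By' yy'].
  have Cxy : C (theta *: x' + (1 - theta) *: y') by exists x' => //; exists y'.
  apply: le_lt_trans (set_dist_le _ Cxy) _.
  rewrite opprD addrACA -!scalerBr; apply: le_lt_trans (ler_normD _ _) _.
  rewrite !normrZ !gtr0_norm //.
  by rewrite (_ : e = theta * e + (1 - theta) * e) ?ltrD ?ltr_pM2l //; ring.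
(* The compact set [C] is closed, hence the intersection of its shrinking neighbourhoods, and
   continuity from above lets [e] tend to 0. *)
have lim : (fine (nu (U C (2 * n.+1%:R^-1)))) @[n --> \oo] --> fine (nu C).
  apply: fine_cvg; rewrite fineK ?fin_num_measure //; last exact: mK.
  have CU : C = \bigcap_n U C (2 * n.+1%:R^-1).
    apply/seteqP; split => [x Cx k _|x Ux].
      by apply: le_lt_trans (dist_self _ _ Cx) _; rewrite mulr_gt0 // invr_gt0.
    apply: set_dist0 => //; first exact: clo.
    apply/eqP; rewrite eq_le set_dist_ge0 // andbT; apply/ler_addgt0Pr => e e0; rewrite add0r.
    pose k := Num.trunc (2 / e).
    have := Ux k I; rewrite /U /= => /ltW/le_trans; apply.
    rewrite ler_pdivrMr ?ltr0n // mulrC -ler_pdivrMr //.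
    by apply: ltW; exact: truncnS_gt.
  rewrite [X in _ --> nu X]CU; apply: nonincreasing_cvg_mu => //.
  - by rewrite ltey_eq fin_num_measure //; exact: mU.
  - by move=> i; exact: mU.
  - by apply: bigcapT_measurable => i; exact: mU.
  - move=> i j ij; apply/subsetPset => x /= h; apply: lt_le_trans h _.
    by rewrite ler_pM2l // lef_pV2 ?posrE // ler_nat.
have {}main : fine (nu A) `^ theta * fine (nu B) `^ (1 - theta) <= fine (nu C).
  apply: ler_cvg_to (cvg_cst _) lim _; apply: nearW => k.
  by apply: main; rewrite invr_gt0.
rewrite -[nu A]fineK ?fin_num_measure //; last exact: mK.
rewrite -[nu B]fineK ?fin_num_measure //; last exact: mK.
by rewrite -[leRHS]fineK ?fin_num_measure //; last exact: (mK C cC).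
Qed.

(** * Convex functionals *)

Definition convex_on (R : realType) (theta : R) (V : lmodType R) (f : V -> R) : Prop :=
  forall x y, f (theta *: x + (1 - theta) *: y) <= theta * f x + (1 - theta) * f y.

Lemma convex_function_on (R : realType) (V : lmodType R) (f : V -> R) :
  convex_function setT f -> forall theta, 0 <= theta <= 1 -> convex_on theta f.
Proof.
move=> cf theta /andP[t0 t1] x y.
by have := cf (Itv01 t0 t1) x y; rewrite !inE => /(_ I I).
Qed.

(** Induction on the number of coordinates allowed to move: [x + h] is the midpoint of two points,
    one moving only the earlier coordinates and the other only the last. The midpoint doubles
    displacements, hence the cube of size [2 * rho] in the induction. *)
Lemma convex_cube_bound (R : realType) (n : nat) (f : 'rV[R]_n -> R) (x : 'rV[R]_n) :
  (forall theta, 0 <= theta <= 1 -> convex_on theta f) ->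
  forall rho : R, 0 < rho ->
    exists M, forall h : 'rV[R]_n, (forall i, `|h 0 i| <= rho) -> f (x + h) <= M.
Proof.
move=> cf.
suff : forall k, (k <= n)%N -> forall rho : R, 0 < rho -> exists M,
    forall h : 'rV[R]_n, (forall i : 'I_n, (k <= i)%N -> h 0 i = 0) ->
    (forall i, `|h 0 i| <= rho) -> f (x + h) <= M.
  move=> /(_ n (leqnn n)) H rho /H[M HM]; exists M => h hr; apply: HM => // i.
  by rewrite leqNgt ltn_ord.
elim=> [_ rho _|k IH kn rho rho0].
  exists (f x) => h h0 _; rewrite (_ : h = 0) ?addr0 //.
  by apply/rowP => i; rewrite h0 // mxE.
have rho20 : 0 < 2 * rho by rewrite mulr_gt0.
have [M HM] := IH (ltnW kn) _ rho20.
pose k' := Ordinal kn; pose e : 'rV[R]_n := delta_mx 0 k'.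
pose M1 := Num.max (f (x + (2 * rho) *: e)) (f (x - (2 * rho) *: e)).
exists (2^-1 * M + (1 - 2^-1) * M1) => h hk hr.
have half : 0 <= (2^-1 : R) <= 1 by apply/andP; split; lra.
pose h1 : 'rV[R]_n := \row_i (if i == k' then 0 else h 0 i).
have hE : x + h = 2^-1 *: (x + 2 *: h1) + (1 - 2^-1) *: (x + (2 * h 0 k') *: e).
  apply/rowP => i; rewrite !mxE eqxx /=; case: eqVneq => [->|_] /=.
    by field.
  by field.
rewrite hE; apply: le_trans (cf _ half _ _) _.
apply: lerD; rewrite ler_pM2l //; [| |lra].
  apply: HM => i.
    rewrite !mxE leq_eqVlt => /predU1P[ki|ki].
      by rewrite ifT ?mulr0 //; apply/eqP/val_inj; rewrite /= -ki.
    by rewrite hk // ?if_same mulr0.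
  rewrite !mxE; case: ifP => _; first by rewrite mulr0 normr0 ltW.
  by rewrite normrM ger0_norm // ler_pM2l.
have := hr k'; rewrite ler_norml => /andP[hl hu].
(* The position of [2 * h 0 k'] in the segment from [- 2 * rho] to [2 * rho]. *)
pose t := (h 0 k' / rho + 1) / 2.
have ht : h 0 k' = rho * (2 * t - 1) by rewrite /t; field; rewrite gt_eqF.
have t01 : 0 <= t <= 1.
  rewrite /t; apply/andP; split.
    by rewrite divr_ge0 // -lerBlDr sub0r ler_pdivlMr // mulN1r.
  by rewrite ler_pdivrMr // mul1r -lerBrDr ler_pdivrMr //; lra.
have eE : x + (2 * h 0 k') *: e = t *: (x + (2 * rho) *: e) + (1 - t) *: (x - (2 * rho) *: e).
  apply/rowP => i; rewrite !mxE ht; case: eqP => _ /=; ring.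
rewrite eE; apply: le_trans (cf _ t01 _ _) _.
have /andP[t0 t1] := t01.
have m1 : f (x + (2 * rho) *: e) <= M1 by rewrite le_max lexx.
have m2 : f (x - (2 * rho) *: e) <= M1 by rewrite le_max lexx orbT.
rewrite (_ : M1 = t * M1 + (1 - t) * M1); last by ring.
by apply: lerD; rewrite ler_wpM2l // subr_ge0.
Qed.

Lemma dist_cvg (R : realType) (V : normedModType R) (f : V -> R) (x : V) :
  (forall e, 0 < e -> exists2 d, 0 < d & forall y, `|x - y| < d -> `|f x - f y| < e) ->
  f y @[y --> x] --> f x.
Proof.
move=> H; apply/cvgrPdist_lt => e /H[d d0 Hd].
have : \forall y \near x, `|x - y| < d by apply: cvgr_dist_lt => //; exact: cvg_id.
exact: filterS.
Qed.

(** Put [u = h / d] with [|h| <= d <= 1]. Convexity between [x] and [x + u] bounds [f (x + h)]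
    above, convexity between [x + h] and [x - u] bounds it below, and the local upper bound [M]
    controls both deviations by [d * (M - f x)]. *)
Lemma convex_continuous (R : realType) (n : nat) (f : 'rV[R]_n -> R) :
  (forall theta, 0 <= theta <= 1 -> convex_on theta f) -> continuous f.
Proof.
move=> cf; suff H (x : 'rV[R]_n) : f y @[y --> x] --> f x by exact: H.
have [M HM] := convex_cube_bound x cf ltr01.
have fxM : f x <= M by have := HM 0; rewrite addr0; apply => i; rewrite mxE normr0.
have key d (h : 'rV[R]_n) : 0 < d -> d <= 1 -> `|h| <= d -> `|f x - f (x + h)| <= d * (M - f x).
  move=> d0 d1 hd; have dn0 : d != 0 by rewrite gt_eqF.
  pose u := d^-1 *: h.
  have ui i : `|u 0 i| <= 1.
    rewrite mxE normrM gtr0_norm ?invr_gt0 // mulrC ler_pdivrMr // mul1r.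
    apply: le_trans hd; rewrite /Num.Def.normr /= mx_normrE.
    by apply/bigmax_geP; right; exists (0, i).
  have u1 : f (x + u) <= M by exact: HM.
  have u2 : f (x - u) <= M by apply: HM => i; rewrite mxE normrN.
  have E1 : x + h = d *: (x + u) + (1 - d) *: x.
    by apply/rowP => i; rewrite !mxE; field.
  have h1 : f (x + h) <= d * f (x + u) + (1 - d) * f x.
    by rewrite E1; apply: cf; rewrite (ltW d0).
  (* The weight for which the displacements [h = d u] and [- u] cancel. *)
  pose t := (1 + d)^-1.
  have d10 : 0 < 1 + d by lra.
  have E2 : x = t *: (x + h) + (1 - t) *: (x - u).
    by apply/rowP => i; rewrite !mxE /t; field; rewrite dn0 gt_eqF.
  have h2 : f x <= t * f (x + h) + (1 - t) * f (x - u).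
    rewrite [X in f X <= _]E2; apply: cf; rewrite /t invr_ge0 (ltW d10) /=.
    by rewrite invf_le1 //; lra.
  have h3 : (1 + d) * f x <= f (x + h) + d * f (x - u).
    have E3 : f (x + h) + d * f (x - u) = (1 + d) * (t * f (x + h) + (1 - t) * f (x - u)).
      by rewrite /t; field; rewrite gt_eqF.
    by rewrite E3 ler_pM2l.
  have h4 : d * f (x + u) <= d * M by rewrite ler_pM2l.
  have h5 : d * f (x - u) <= d * M by rewrite ler_pM2l.
  by rewrite ler_norml; apply/andP; split; lra.
apply: dist_cvg => e e0.
(* The added 1 keeps the denominator positive when [M = f x]. *)
pose d := Num.min 1 (e / (2 * (M - f x + 1))).
have Mp : 0 < 2 * (M - f x + 1) by lra.
have d0 : 0 < d by rewrite lt_min ltr01 divr_gt0.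
have d1 : d <= 1 by rewrite ge_min lexx.
exists d => // y xy.
have := key d (y - x) d0 d1; rewrite distrC subrKC => /(_ (ltW xy)) h.
apply: le_lt_trans h _.
apply: (@le_lt_trans _ _ (d * (M - f x + 1))); first by rewrite ler_pM2l //; lra.
have : d <= e / (2 * (M - f x + 1)) by rewrite ge_min lexx orbT.
by rewrite ler_pdivlMr // => h'; lra.
Qed.

(** Heine-Cantor from the near-covering form of compactness: a radius [r] valid at [x] for [e / 2]
    gives [r / 2] as a radius for [e] at all points within [r / 2] of [x]. *)
Lemma segment_uniform_continuous (R : realType) (a b : R) (u : R -> R) (e : R) :
  0 < e -> {within `[a, b], continuous u} ->
  exists2 d, 0 < d & forall x y, x \in `[a, b] -> y \in `[a, b] ->
    `|x - y| < d -> `|u x - u y| < e.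
Proof.
move=> e0 /subspace_continuousP cu.
have := @segment_compact R a b; rewrite compact_near_coveringP => cov.
pose P (d x : R) := x \in `[a, b] -> forall y, y \in `[a, b] -> `|x - y| < d -> `|u x - u y| < e.
have : \forall d \near 0^'+, `[a, b] `<=` P d.
  apply: cov => x xab.
  have /cvgrPdist_lt/(_ (e / 2)) := cu x xab.
  rewrite divr_gt0 // => /(_ isT); rewrite near_withinE.
  move=> /nbhs_ballP[r /= r0 Hr].
  have r20 : 0 < r / 2 by rewrite divr_gt0.
  have H y : y \in `[a, b] -> `|x - y| < r -> `|u x - u y| < e / 2 by move=> yab xy; apply: Hr.
  near=> x' d => x'ab y yab x'y.
  have xx' : `|x - x'| < r / 2 by near: x'; apply: cvgr_dist_lt => //; exact: cvg_id.
  have dr : d < r / 2 by near: d; exact: nbhs_right_lt.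
  have h1 : `|u x - u x'| < e / 2 by apply: H => //; lra.
  have h2 : `|u x - u y| < e / 2.
    apply: H => //; rewrite -(subrKA x'); apply: le_lt_trans (ler_normD _ _) _.
    by move: x'y => /= x'y; lra.
  rewrite -(subrKA (u x)); apply: le_lt_trans (ler_normD _ _) _.
  by rewrite distrC; lra.
move=> H.
have [d d0 Hd] : exists2 d : R, 0 < d & `[a, b] `<=` P d.
  near (0:R)^'+ => d; exists d => //.
  by near: d; exact: H.
exists d => // x y xab yab; exact: Hd.
Unshelve. all: by end_near.
Qed.

Lemma riemann_sum_cvg (R : realType) (a b : R) (u : R -> R) :
  a < b -> {within `[a, b], continuous u} ->
  (\sum_(k < n.+1) (b - a) / n.+1%:R * u (a + k%:R * ((b - a) / n.+1%:R)))
    @[n --> \oo] --> \int[lebesgue_measure]_(s in `[a, b]) u s.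
Proof.
move=> ab cu.
have iu : lebesgue_measure.-integrable `[a, b] (EFin \o u).
  by apply: continuous_compact_integrable => //; exact: segment_compact.
apply/cvgrPdist_le => e e0.
have ba : 0 < b - a by rewrite subr_gt0.
(* On each cell the integrand stays within [e'] of its value at the left end, so the total error is
   at most [e' * (b - a) = e]. *)
pose e' := e / (b - a).
have e'0 : 0 < e' by rewrite divr_gt0.
have [d d0 Hd] := segment_uniform_continuous e'0 cu.
exists (Num.trunc ((b - a) / d)).+1 => // n /= nd.
set D := (b - a) / n.+1%:R.
have n0 : 0 < n.+1%:R :> R by rewrite ltr0n.
have D0 : 0 < D by rewrite divr_gt0.
have Dd : D < d.
  rewrite ltr_pdivrMr // -ltr_pdivrMl // mulrC.
  apply: lt_le_trans (truncnS_gt _) _; rewrite ler_nat.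
  by apply: leq_trans nd _.
pose tau (k : nat) := a + k%:R * D.
have tauS k : tau k.+1 = tau k + D by rewrite /tau -natr1; ring.
have taun : tau n.+1 = b by rewrite /tau /D; field; rewrite gt_eqF.
have tau_ab k : (k <= n.+1)%N -> tau k \in `[a, b].
  move=> kn; rewrite in_itv /= /tau lerDl mulr_ge0 ?(ltW D0) //=.
  by rewrite -taun /tau lerD2l ler_pM2r // ler_nat.
pose I (k : nat) := \int[lebesgue_measure]_(s in `[a, tau k]) u s.
have step (k : nat) : (k < n.+1)%N -> `|(I k.+1 - I k) - D * u (tau k)| <= e' * D.
  move=> kn; have tab := tau_ab _ (ltnW kn); have := tau_ab _ kn.
  move: (tab); rewrite !in_itv /= => /andP[at_ tb] /andP[aS Sb].
  have iS (w : R -> R) (x y : R) (b1 b2 : bool) : {within `[a, b], continuous w} ->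
     a <= x -> y <= b ->
     lebesgue_measure.-integrable [set` Interval (BSide b1 x) (BSide b2 y)] (EFin \o w).
    move=> cw ax yb.
    have iw : lebesgue_measure.-integrable `[a, b] (EFin \o w).
      by apply: continuous_compact_integrable => //; exact: segment_compact.
    apply: integrableS iw => //.
    by apply: subset_itv; rewrite bnd_simp //; case: b1; case: b2.
  have cc (c : R) : {within `[a, b], continuous (fun=> c : R)} by move=> s; exact: cvg_cst.
  have cB (c : R) : {within `[a, b], continuous (fun s => u s - c : R)}.
    by move=> s; apply: cvgB; [exact: cu|exact: cvg_cst].
  have cN : {within `[a, b], continuous (fun s => `|u s - u (tau k)| : R)}.
    by move=> s; apply: cvg_norm; exact: cB.
  rewrite /I Rintegral_itvB; first last.
  - by rewrite bnd_simp tauS lerDl ltW.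
  - by rewrite bnd_simp.
  - exact: iS.
  have tt : tau k < tau k.+1 by rewrite tauS ltrDl.
  have IC c : \int[lebesgue_measure]_(s in `]tau k, tau k.+1]) c = c * D.
    rewrite Rintegral_cst //; congr (_ * _).
    transitivity (fine (lebesgue_measure `]tau k, tau k.+1]%classic)) => //.
    by rewrite lebesgue_measure_itv /= lte_fin tt -EFinB /= tauS addrAC subrr add0r.
  rewrite mulrC -IC -RintegralB //; last 2 first.
  - exact: iS.
  - exact: iS.
  apply: le_trans (le_normr_Rintegral _ _) _ => //; first exact: iS.
  rewrite -[leRHS]IC.
  apply: le_Rintegral => //; [exact: iS|exact: iS|].
  move=> s /=; rewrite in_itv /= => /andP[s1 s2].
  apply/ltW/Hd => //; first by rewrite in_itv /=; apply/andP; split; lra.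
  rewrite gtr0_norm ?subr_gt0 //; apply: le_lt_trans Dd.
  by rewrite lerBlDl -tauS.
have IE : \int[lebesgue_measure]_(s in `[a, b]) u s = \sum_(k < n.+1) (I k.+1 - I k).
  rewrite -(big_mkord xpredT (fun k => I k.+1 - I k)) telescope_sumr //.
  by rewrite /I taun /tau mul0r addr0 set_itv1 Rintegral_set1 subr0.
rewrite IE -sumrB; apply: le_trans (ler_norm_sum _ _ _) _.
apply: (@le_trans _ _ (\sum_(k < n.+1) e' * D)).
  by apply: ler_sum => k _; exact: step.
rewrite sumr_const card_ord -mulr_natr /e' /D.
by rewrite le_eqVlt; apply/orP; left; apply/eqP; field; rewrite gt_eqF //= gt_eqF.
Qed.

Lemma convex_on_max (R : realType) (theta c : R) (V : lmodType R) (f : V -> R) :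
  0 <= theta <= 1 -> convex_on theta f -> convex_on theta (fun v => Num.max (f v) c).
Proof.
move=> /andP[t0 t1] cf x y.
have u0 : 0 <= 1 - theta by rewrite subr_ge0.
rewrite ge_max; apply/andP; split.
  apply: le_trans (cf x y) _.
  by apply: lerD; rewrite ler_wpM2l // le_max lexx.
rewrite [leLHS](_ : c = theta * c + (1 - theta) * c); last by ring.
by apply: lerD; rewrite ler_wpM2l // le_max lexx orbT.
Qed.

Lemma Rintegral_dominated_cvg (R : realType) d (T : measurableType d)
    (mu : {measure set T -> \bar R}) (h : nat -> T -> R) (k g : T -> R) :
  (forall n, measurable_fun setT (h n)) ->
  (forall x, h n x @[n --> \oo] --> k x) ->
  mu.-integrable setT (EFin \o g) -> (forall n x, `|h n x| <= g x) ->
  \int[mu]_x h n x @[n --> \oo] --> \int[mu]_x k x.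
Proof.
move=> mh hk ig hg.
have mk : measurable_fun setT k by apply: measurable_fun_cvg mh _ => x _; exact: hk.
have kg x : `|k x| <= g x.
  have : `|h n x| @[n --> \oo] --> `|k x| by apply: cvg_norm; exact: hk.
  move=> /ler_cvg_to/(_ (cvg_cst (g x)))/(_ (nearW _ _)); apply => n; exact: hg.
have ik : mu.-integrable setT (EFin \o k).
  apply: le_integrable ig => //; first exact/measurable_EFinP.
  by move=> x _ /=; rewrite lee_fin (le_trans (kg x)) // ler_norm.
apply: fine_cvg; rewrite fineK; last exact: integrable_fin_num.
apply: (@dominated_cvg _ _ _ mu setT measurableT (fun n x => (h n x)%:E)
   (fun x => (k x)%:E) (EFin \o g)) => //.
- by move=> n; apply/measurable_EFinP.
- by move=> x _; apply: cvg_EFin; [exact: nearW|exact: hk].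
- by move=> n x _ /=; rewrite lee_fin.
Qed.

(** * Sampled paths and tilted measures *)

Section clamp.
Context (R : realType).

(** The retraction onto [[a, b]]; composing with it extends paths and integrands continuously to the
    whole line and keeps them inside the domain of [F]. *)
Definition clamp (a b t : R) : R := Num.max a (Num.min b t).

Lemma clamp_in a b t : a <= b -> clamp a b t \in `[a, b].
Proof. by move=> ab; rewrite in_itv /= /clamp le_max lexx /= ge_max ab ge_min lexx. Qed.

Lemma clamp_id a b t : t \in `[a, b] -> clamp a b t = t.
Proof. by rewrite in_itv /= /clamp => /andP[at_ tb]; rewrite min_r // max_r. Qed.

Lemma clamp_continuous a b : continuous (clamp a b).
Proof.
move=> x; have cc (c : R) : {for x, continuous (fun=> c : R^o)} by exact: cvg_cst.
have ci : {for x, continuous (idfun : R -> R^o)} by exact: cvg_id.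
exact: continuous_max (cc a) (continuous_min (cc b) ci).
Qed.

End clamp.

Lemma site_dom (R : realType) (r : rectangle R) (i : 'I_(width r)) (t : R) :
  dom r (site i, clamp (left_end r) (right_end r) t).
Proof.
split => /=; last by apply: clamp_in; rewrite ltW // left_lt_right.
have := lo_le_hi r; have := ltn_ord i; rewrite in_itv /= /site /width; lia.
Qed.

Definition point_at (R : realType) (r : rectangle R) (i : 'I_(width r)) (t : R) : dom r :=
  exist _ (site i, clamp (left_end r) (right_end r) t) (mem_set (site_dom i t)).

Lemma point_at_continuous (R : realType) (r : rectangle R) (i : 'I_(width r)) :
  continuous (point_at i).
Proof.
apply: continuous_comp_initial => t.
rewrite (_ : set_val \o _ =
  fun s => (site i, clamp (left_end r) (right_end r) s)) //.
have c1 : (fun=> (site i : discrete_topology int)) s @[s --> t] --> (site i : discrete_topology int).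
  exact: cvg_cst.
exact: cvg_pair c1 (@clamp_continuous R (left_end r) (right_end r) t).
Qed.

Lemma line_point_at (R : realType) (r : rectangle R) (z : cfun (dom r)) i t :
  t \in `[left_end r, right_end r] -> line z i t = z (point_at i t).
Proof.
move=> tab.
have E : sval (point_at i t) = (site i, t) by rewrite /= clamp_id.
rewrite /line -E.
by have /(congr1 (fun f => f (point_at i t))) := valLK 0 (z : dom r -> R); rewrite /sigL.
Qed.

Lemma slice_point_at (R : realType) (r : rectangle R) (z : cfun (dom r)) t :
  t \in `[left_end r, right_end r] -> slice z t = \row_i z (point_at i t).
Proof. by move=> tab; apply/rowP => i; rewrite !mxE line_point_at. Qed.

Lemma measurable_slice (R : realType) (r : rectangle R) (g : 'rV[R]_(width r) -> R) t :
  continuous g -> t \in `[left_end r, right_end r] ->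
  measurable_fun setT (fun z : borel (cfun (dom r)) => g (slice z t)).
Proof.
move=> cg tab.
rewrite (_ : (fun z => _) = g \o eval_at (fun i => point_at i t)); last first.
  by apply/funext => z /=; rewrite slice_point_at.
apply: (measurableT_comp (continuous_borel_real cg)).
exact: measurable_funP.
Qed.

(** Evaluating jointly at the points [q] and on all lines at the times [s j] makes the indicator and
    the weight functions of one vector, to which [PL] applies. The lower bound [- K] on each of the
    [N] terms bounds the weight by [expR (K *+ N)]. *)
Lemma prekopa_leindler_tilted (R : realType) (theta K : R) (r : rectangle R)
    (gamma : probability (borel (cfun (dom r))) R) (N : nat) (s : 'I_N -> R)
    (U : 'I_N -> 'rV[R]_(width r) -> R) (n : nat) (q : 'I_n -> dom r)
    (A B C : set (borel 'rV[R]_n)) (w : borel (cfun (dom r)) -> R) :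
  0 < theta < 1 ->
  (forall N (q : 'I_N -> dom r), prekopa_leindler theta (distribution gamma (eval_at q))
    (fun x y => theta *: x + (1 - theta) *: y)) ->
  (forall j, s j \in `[left_end r, right_end r]) ->
  (forall j, continuous (U j)) -> (forall j, convex_on theta (U j)) ->
  (forall j v, - K <= U j v) ->
  measurable A -> measurable B -> measurable C ->
  (forall x y, A x -> B y -> C (theta *: (x : 'rV[R]_n) + (1 - theta) *: (y : 'rV[R]_n))) ->
  (forall z, w z = expR (- \sum_j U j (slice z (s j)))) ->
  (\int[gamma]_z (\1_A (eval_at q z) * w z)) `^ theta *
  (\int[gamma]_z (\1_B (eval_at q z) * w z)) `^ (1 - theta) <=
  \int[gamma]_z (\1_C (eval_at q z) * w z).
Proof.
move=> t01 PL sab Uc Ucvx UK mA mB mC ABC wE; have /andP[t0 t1] := t01.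
pose I := ('I_n + 'I_N * 'I_(width r))%type.
pose q' (k : 'I_#|{: I}|) : dom r :=
  match enum_val k with inl i => q i | inr (j, i) => point_at i (s j) end.
pose sub1 (v : 'rV[R]_#|{: I}|) : 'rV[R]_n := \row_i v 0 (enum_rank (inl i : I)).
pose sub2 j (v : 'rV[R]_#|{: I}|) : 'rV[R]_(width r) := \row_i v 0 (enum_rank (inr (j, i) : I)).
pose u (v : 'rV[R]_#|{: I}|) := expR (- \sum_j U j (sub2 j v)).
have sub1E z : sub1 (eval_at q' z) = eval_at q z.
  by apply/rowP => i; rewrite !mxE /q' enum_rankK.
have uE z : u (eval_at q' z) = w z.
  rewrite /u wE; congr (expR (- _)); apply: eq_bigr => j _; congr (U j _).
  by apply/rowP => i; rewrite slice_point_at // !mxE /q' enum_rankK.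
have mcoord k : measurable_fun setT (fun v : borel 'rV[R]_#|{: I}| => (v : 'rV[R]_#|{: I}|) 0 k).
  by apply: continuous_borel_real; exact: coord_continuous.
have msub1 : measurable_fun setT (sub1 : borel _ -> borel _).
  by apply: measurable_rV => i; under eq_fun do rewrite mxE; exact: mcoord.
have msub2 j : measurable_fun setT (sub2 j : borel _ -> borel _).
  by apply: measurable_rV => i; under eq_fun do rewrite mxE; exact: mcoord.
have mu_ : measurable_fun setT (u : borel _ -> R).
  apply: measurableT_comp; first exact: measurable_expR.
  apply: measurable_funN; apply: measurable_sum => j.
  exact: measurableT_comp (continuous_borel_real (Uc j)) (msub2 j).
have mF (D : set (borel 'rV[R]_n)) : measurable D ->
    measurable_fun setT (fun v : borel 'rV[R]_#|{: I}| => \1_D (sub1 v) * u v).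
  move=> mD; apply: measurable_funM => //.
  exact: measurableT_comp (measurable_indic mD) msub1.
have uK v : 0 <= u v <= expR (K *+ N).
  rewrite expR_ge0 /= ler_expR lerNl -mulNrn.
  by rewrite -[leLHS](_ : \sum_(j < N) - K = _) ?ler_sum // sumr_const card_ord.
have FK (D : set (borel 'rV[R]_n)) v : 0 <= \1_D (sub1 v) * u v <= expR (K *+ N).
  have /andP[u0 u1] := uK v; rewrite indicE.
  by case: (_ \in _); rewrite ?mul1r ?mul0r ?u0 ?lexx ?expR_ge0.
have E (D : set (borel 'rV[R]_n)) : measurable D ->
    \int[gamma]_z (\1_D (eval_at q z) * w z) =
    \int[distribution gamma (eval_at q')]_v (\1_D (sub1 v) * u v).
  move=> mD; rewrite /Rintegral; congr fine.
  rewrite ge0_integral_pushforward //; last 2 first.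
  - by apply/measurable_EFinP; exact: mF.
  - by move=> v _; rewrite lee_fin; case/andP: (FK D v).
  by apply: eq_integral => z _ /=; rewrite sub1E uE.
rewrite !E //.
apply: (PL _ q' _ _ _ (expR (K *+ N))); try exact: mF; try exact: FK.
(* Off [A] or [B] the left side vanishes because both exponents are positive; otherwise the claim is
   convexity of the exponent. *)
move=> x y; rewrite !indicE.
have := ABC (sub1 x) (sub1 y).
have [xA|xA] := boolP (sub1 x \in A); last first.
  by rewrite mul0r powR0 ?gt_eqF // mul0r => _; case/andP: (FK C (theta *: x + (1 - theta) *: y)); rewrite indicE.
have [yB|yB] := boolP (sub1 y \in B); last first.
  rewrite mul0r [X in _ * X]powR0 ?mulr0 ?gt_eqF ?subr_gt0 // => _.
  by case/andP: (FK C (theta *: x + (1 - theta) *: y)); rewrite indicE.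
rewrite !inE in xA yB => /(_ xA yB) Cxy.
rewrite (_ : sub1 (theta *: x + _) \in C); last first.
  by rewrite inE; congr C: Cxy; apply/rowP => i; rewrite !mxE.
rewrite !mul1r /u -!expRM -expRD ler_expR.
rewrite !mulNr -opprD lerN2 !mulr_suml -big_split /=.
apply: ler_sum => j _.
rewrite mulrC [X in _ <= _ + X]mulrC.
apply: le_trans (Ucvx j _ _); rewrite le_eqVlt; apply/orP; left; apply/eqP; congr (U j _).
by apply/rowP => i; rewrite !mxE.
Qed.

Lemma rV_cvg (R : realType) (T : topologicalType) n (g : T -> 'rV[R]_n) (x : T) :
  (forall i, g y 0 i @[y --> x] --> g x 0 i) -> g y @[y --> x] --> g x.
Proof.
move=> gx A [P Pz PA].
have : \forall y \near x, forall i, P ord0 i (g y 0 i).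
  by apply: filter_forall => i; apply: gx; exact: Pz.
by apply: filterS => y Py; apply: PA => k i; rewrite ord1.
Qed.

Lemma continuous_along_path (R : realType) (r : rectangle R)
    (F : R * 'rV[R]_(width r) -> R) (z : cfun (dom r)) :
  let a := left_end r in let b := right_end r in
  {within `[a, b] `*` setT, continuous F} ->
  continuous (fun s => F (clamp a b s, \row_i z (point_at i s))).
Proof.
move=> a b /subspace_continuousP cF s.
have ab : a <= b by rewrite ltW // left_lt_right.
pose psi s : R * 'rV[R]_(width r) := (clamp a b s, \row_i z (point_at i s)).
have D s' : (`[a, b] `*` setT) (psi s') by split => //; exact: clamp_in.
have cpsi : psi s' @[s' --> s] --> psi s.
  have c2 : (\row_i z (point_at i s')) @[s' --> s] --> (\row_i z (point_at i s) : 'rV[R]_(width r)).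
    apply: rV_cvg => i; under eq_fun do rewrite mxE; rewrite mxE.
    apply: (cvg_comp (point_at i) z); first exact: point_at_continuous.
    exact: cts_fun.
  exact: cvg_pair (@clamp_continuous R a b s) c2.
move=> W FW.
have H0 : nbhs (psi s) [set v | (`[a, b] `*` setT) v -> W (F v)].
  exact: cF (psi s) (D s) W FW.
have H1 : nbhs s (psi @^-1` [set v | (`[a, b] `*` setT) v -> W (F v)]) := cpsi _ H0.
by apply: (filterS _ H1) => s' /=; apply; exact: D.
Qed.

Lemma continuous_max_cst (R : realType) (T : topologicalType) (g : T -> R) (c : R) :
  continuous g -> continuous (fun v => Num.max (g v) c).
Proof.
move=> cg v; have cm : continuous (fun y : R => Num.max y c).
  move=> y; have cc : {for y, continuous (fun=> c : R^o)} by exact: cvg_cst.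
  have ci : {for y, continuous ((fun x => x) : R -> R^o)} by exact: cvg_id.
  exact: continuous_max ci cc.
exact: (cvg_comp _ (fun y : R => Num.max y c) (cg v) (cm (g v))).
Qed.

(** The order of the limits matters for domination: for fixed [M] the truncated sums are bounded
    below uniformly in [G], so a constant dominates; afterwards truncation only raises [H], so
    [expR (- H)] dominates. *)
Lemma basic_measure_log_concave (R : realType) (theta : R) (r : rectangle R)
    (mu : probability (borel (cfun (dom r))) R) (n : nat) (q : 'I_n -> dom r)
    (A B C : set (borel 'rV[R]_n)) :
  basic_measure mu -> 0 < theta < 1 ->
  measurable A -> measurable B -> measurable C ->
  (forall x y, A x -> B y -> C (theta *: (x : 'rV[R]_n) + (1 - theta) *: (y : 'rV[R]_n))) ->
  fine (distribution mu (eval_at q) A) `^ theta *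
  fine (distribution mu (eval_at q) B) `^ (1 - theta) <=
  fine (distribution mu (eval_at q) C).
Proof.
move=> [gamma [H [gammaP [m [t [f [F [tab cf cF cFs HE]]]]] [c c0 muE]]]] t01 mA mB mC ABC.
have /andP[t0 t1] := t01.
have t01' : 0 <= theta <= 1 by rewrite !ltW.
have PL N (q : 'I_N -> dom r) := prekopa_leindler_gaussian q t01 gammaP.
set a := left_end r in tab cF cFs HE; set b := right_end r in tab cF cFs HE.
have ab : a < b by exact: left_lt_right.
have ba : 0 < b - a by rewrite subr_gt0.
have cvxf i := convex_function_on (cf i).
have cvxF s := fun sab => convex_function_on (cFs s sab).
have ctsf i : continuous (f i) by apply: convex_continuous; exact: cvxf.
have ctsF s : s \in `[a, b] -> continuous (fun v : 'rV[R]_(width r) => F (s, v)).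
  by move=> sab; apply: convex_continuous; exact: cvxF.
pose u (z : cfun (dom r)) s := F (clamp a b s, \row_i z (point_at i s)).
have cu z : continuous (u z) by exact: continuous_along_path.
have uE z s : s \in `[a, b] -> u z s = F (s, slice z s).
  by move=> sab; rewrite /u clamp_id // slice_point_at.
have mx0 (x y : R) : x <= Num.max x y by rewrite le_max lexx.
have mx1 (x y : R) : y <= Num.max x y by rewrite le_max lexx orbT.
have cum z M : {within `[a, b], continuous (fun s => Num.max (u z s) (- M%:R) : R)}.
  by apply: continuous_subspaceT; exact: continuous_max_cst.
pose D (G : nat) : R := (b - a) / G.+1%:R.
have D0 G : 0 < D G by rewrite divr_gt0.
have DG G : D G <= b - a.
  by rewrite ler_pdivrMr ?ltr0n // ler_peMr ?(ltW ba) // ler1n.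
have tau_ab G (k : nat) : (k <= G.+1)%N -> a + k%:R * D G \in `[a, b].
  move=> kG; rewrite in_itv /= lerDl mulr_ge0 ?(ltW (D0 G)) //=.
  rewrite -lerBrDl /D mulrA ler_pdivrMr ?ltr0n // mulrC ler_pM2l // ler_nat //.
(* The integrands are truncated below at [- M], for the density to be bounded, and
   the time integral is replaced by a Riemann sum with [G + 1] terms. *)
pose I M (z : cfun (dom r)) := \sum_i Num.max (f i (slice z (t i))) (- M%:R).
pose VG (M G : nat) z := I M z + \sum_(k < G.+1) D G * Num.max (u z (a + k%:R * D G)) (- M%:R).
pose V (M : nat) z := I M z + \int[lebesgue_measure]_(s in `[a, b]) Num.max (u z s) (- M%:R).
have Ilow M z : - (m%:R * M%:R) <= I M z.
  rewrite mulr_natl -mulNrn -[leLHS](_ : \sum_(i < m) - M%:R = _).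
    by apply: ler_sum => i _; exact: mx1.
  by rewrite sumr_const card_ord.
have VGlow M G z : - (m%:R * M%:R + (b - a) * M%:R) <= VG M G z.
  rewrite opprD; apply: lerD => //.
  apply: (@le_trans _ _ (\sum_(k < G.+1) D G * - M%:R)); last first.
    by apply: ler_sum => k _; rewrite ler_pM2l.
  rewrite sumr_const card_ord -[_ *+ G.+1]mulr_natr /D le_eqVlt; apply/orP; left; apply/eqP.
  by rewrite mulrAC divfK ?pnatr_eq0 // mulrN.
pose s_ G (j : 'I_(m + G.+1)%N) : R :=
  match fintype.split j with inl i => t i | inr k => a + k%:R * D G end.
pose U_ (M G : nat) (j : 'I_(m + G.+1)%N) (v : 'rV[R]_(width r)) : R :=
  match fintype.split j with inl i => Num.max (f i v) (- M%:R)
  | inr k => D G * Num.max (F (a + k%:R * D G, v)) (- M%:R) end.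
have s_ab G j : s_ G j \in `[a, b].
  by rewrite /s_; case: fintype.split => [i|k]; [exact: tab|apply: tau_ab; exact: ltnW].
have cmaxv (g : 'rV[R]_(width r) -> R) (M : nat) : continuous g ->
    continuous (fun v => Num.max (g v) (- M%:R)) by exact: continuous_max_cst.
have U_c M G j : continuous (U_ M G j).
  rewrite /U_; case: fintype.split => [i|k]; first exact: cmaxv.
  move=> v; have cm := cmaxv _ M (ctsF _ (tau_ab G k (ltnW (ltn_ord k)))) v.
  exact: (cvg_comp _ (fun y : R => D G * y) cm (@mulrl_continuous R (D G) _)).
have U_cvx M G j : convex_on theta (U_ M G j).
  rewrite /U_; case: fintype.split => [i|k]; first by apply: convex_on_max => //; exact: cvxf.
  have sab := tau_ab G k (ltnW (ltn_ord k)).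
  have := convex_on_max (- M%:R) t01' (cvxF _ sab _ t01') => h x y.
  by rewrite (mulrCA theta) (mulrCA (1 - theta)) -mulrDr ler_pM2l //; exact: h.
(* One bound for both kinds of terms, as every mesh [D G] is at most [b - a]. *)
have U_low M G j v : - (M%:R * (1 + (b - a))) <= U_ M G j v.
  rewrite /U_; case: fintype.split => [i|k].
    apply: le_trans (mx1 _ _); rewrite lerN2 ler_peMr // lerDl; exact: ltW.
  apply: (@le_trans _ _ (D G * - M%:R)); last by rewrite ler_pM2l.
  rewrite mulrN lerN2 mulrC ler_wpM2l //.
  by apply: le_trans (DG G) _; rewrite lerDr.
have VGE M G z : VG M G z = \sum_j U_ M G j (slice z (s_ G j)).
  rewrite big_split_ord /=; congr (_ + _); apply: eq_bigr => i _.
    by rewrite /U_ /s_ (unsplitK (inl i)).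
  rewrite /U_ /s_ (unsplitK (inr i)) uE //; apply: tau_ab; exact: ltnW.
pose ev := eval_at q.
pose J (w : cfun (dom r) -> R) (S : set (borel 'rV[R]_n)) :=
  \int[gamma]_z (\1_S (ev z) * w z).
have mVG M G : measurable_fun setT (fun z : borel (cfun (dom r)) => expR (- VG M G z)).
  rewrite [X in measurable_fun _ X](_ : _ =
      (fun z => expR (- \sum_j U_ M G j (slice z (s_ G j))))); last first.
    by apply/funext => z; rewrite VGE.
  apply: measurableT_comp; first exact: measurable_expR.
  apply: measurable_funN.
  by apply: measurable_sum => j; exact: measurable_slice.
have VGcvg M z : expR (- VG M G z) @[G --> \oo] --> expR (- V M z).
  apply: (cvg_comp _ expR); last exact: continuous_expR.
  apply: cvgN; apply: cvgD; first exact: cvg_cst.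
  exact: riemann_sum_cvg ab (cum z M).
(* Measurability of the integral functional comes from its Riemann sums, which depend on finitely
   many values of the path. *)
have mV M : measurable_fun setT (fun z : borel (cfun (dom r)) => expR (- V M z)).
  by apply: measurable_fun_cvg (mVG M) _ => z _; exact: VGcvg.
have Vcvg z : expR (- V M z) @[M --> \oo] --> expR (- H z).
  (* For a fixed path the finitely many values of the [f i] and the minimum of the integrand over
     [[a, b]] are finite, so the truncation is eventually inactive. *)
  apply: cvg_near_cst.
  have [s1 _ s1min] := EVT_min (ltW ab) (continuous_subspaceT (cu z)).
  pose K := `|u z s1| + \sum_i `|f i (slice z (t i))|.
  exists (Num.trunc K).+1 => // M /= KM.
  have KM' : K <= M%:R.
    by apply: ltW; apply: lt_le_trans (truncnS_gt _) _; rewrite ler_nat.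
  have K1 : `|u z s1| <= M%:R by apply: le_trans KM'; rewrite lerDl sumr_ge0.
  have K2 i : `|f i (slice z (t i))| <= M%:R.
    apply: le_trans KM'; rewrite /K (bigD1 i) //= addrCA lerDl addr_ge0 // sumr_ge0 //.
  congr (expR (- _)); rewrite HE; congr (_ + _).
    apply: eq_bigr => i _; rewrite max_l //.
    by have := K2 i; rewrite ler_norml => /andP[].
  apply: eq_Rintegral => s; rewrite inE => sab; rewrite uE // max_l // -uE //.
  apply: le_trans (s1min s sab).
  by have := K1; rewrite ler_norml => /andP[].
have mH : measurable_fun setT (fun z : borel (cfun (dom r)) => expR (- H z)).
  by apply: measurable_fun_cvg mV _ => z _; exact: Vcvg.
have HV M z : H z <= V M z.
  rewrite HE; apply: lerD; first by apply: ler_sum => i _; exact: mx0.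
  have -> : \int[lebesgue_measure]_(s in `[a, b]) F (s, slice z s) =
      \int[lebesgue_measure]_(s in `[a, b]) u z s.
    by apply: eq_Rintegral => s; rewrite inE => sab; rewrite uE.
  apply: le_Rintegral => //.
  - apply: continuous_compact_integrable; first exact: segment_compact.
    exact: continuous_subspaceT.
  - apply: continuous_compact_integrable; first exact: segment_compact.
    exact: cum.
have eH0 z : (0 <= (expR (- H z))%:E)%E by rewrite lee_fin expR_ge0.
(* An infinite total mass is excluded because [c] times it equals 1 with [c > 0]. *)
have iH : gamma.-integrable setT (EFin \o (fun z => expR (- H z))).
  apply/integrableP; split; first exact/measurable_EFinP.
  under eq_integral do rewrite /= ger0_norm ?expR_ge0 //.
  have := muE setT measurableT; rewrite probability_setT.
  case E : (\int[gamma]_z _)%E => [x| |]; rewrite ?ltry //.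
  by rewrite gt0_muley ?lte_fin.
have indic01 (S : set (borel 'rV[R]_n)) y : 0 <= (\1_S y : R) <= 1.
  by rewrite indicE; case: (_ \in _); rewrite ?ler01 ?lexx.
have mind S : measurable S -> measurable_fun setT (fun z : borel (cfun (dom r)) => \1_S (ev z) : R).
  by move=> mS; apply: measurableT_comp (measurable_indic mS) _; exact: measurable_funP.
have JG M S : measurable S -> J (fun z => expR (- VG M G z)) S @[G --> \oo] --> J (fun z => expR (- V M z)) S.
  move=> mS.
  apply: (@Rintegral_dominated_cvg _ _ _ gamma _ _ (cst (expR (m%:R * M%:R + (b - a) * M%:R)))).
  - by move=> G; apply: measurable_funM => //; exact: mind.
  - by move=> z; apply: cvgMr; exact: VGcvg.
  - exact: finite_measure_integrable_cst.
  - move=> G z; have /andP[i0 i1] := indic01 S (ev z).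
    rewrite ger0_norm ?mulr_ge0 ?expR_ge0 //.
    apply: (@le_trans _ _ (expR (- VG M G z))); first by rewrite ler_piMl ?expR_ge0.
    by rewrite ler_expR lerNl.
have JM S : measurable S -> J (fun z => expR (- V M z)) S @[M --> \oo] --> J (fun z => expR (- H z)) S.
  move=> mS.
  apply: (@Rintegral_dominated_cvg _ _ _ gamma _ _ (fun z => expR (- H z))) => //.
  - by move=> M; apply: measurable_funM => //; exact: mind.
  - by move=> z; apply: cvgMr; exact: Vcvg.
  - move=> M z; have /andP[i0 i1] := indic01 S (ev z).
    rewrite ger0_norm ?mulr_ge0 ?expR_ge0 //.
    apply: (@le_trans _ _ (expR (- V M z))); first by rewrite ler_piMl ?expR_ge0.
    by rewrite ler_expR lerN2.
have J0 w S : (forall z, 0 <= w z) -> 0 <= J w S.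
  by move=> w0; apply: Rintegral_ge0 => z _; rewrite mulr_ge0 //; case/andP: (indic01 S (ev z)).
have key : J (fun z => expR (- H z)) A `^ theta * J (fun z => expR (- H z)) B `^ (1 - theta)
    <= J (fun z => expR (- H z)) C.
  apply: powR_le_lim (JM _ mA) (JM _ mB) (JM _ mC) _ => //; try by apply: J0 => z; exact: expR_ge0.
  move=> M.
  apply: powR_le_lim (JG M _ mA) (JG M _ mB) (JG M _ mC) _ => //; try by apply: J0 => z; exact: expR_ge0.
  move=> G.
  have wE z : expR (- VG M G z) = expR (- \sum_j U_ M G j (slice z (s_ G j))) by rewrite VGE.
  exact: (@prekopa_leindler_tilted R theta (M%:R * (1 + (b - a))) r gamma (m + G.+1)%N (s_ G) (U_ M G)
    n q A B C (fun z => expR (- VG M G z)) t01 PL (s_ab G) (U_c M G) (U_cvx M G) (U_low M G)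
    mA mB mC ABC wE).
have muJ S : measurable S -> fine (distribution mu (eval_at q) S) = c * J (fun z => expR (- H z)) S.
  move=> mS; rewrite /distribution /pushforward muE; last first.
    by rewrite -[X in measurable X]setTI; exact: measurable_funP.
  rewrite integral_mkcond.
  rewrite (eq_integral (fun z => (\1_S (ev z) * expR (- H z))%:E)); last first.
    move=> z _; rewrite patchE indicE.
    rewrite (_ : (z \in eval_at q @^-1` S) = (ev z \in S)); last by apply/idP/idP; rewrite !inE.
    by case: ifP; rewrite ?mul1r ?mul0r.
  rewrite fineM //; apply: integrable_fin_num => //.
  apply: le_integrable iH => //.
    by apply/measurable_EFinP; apply: measurable_funM => //; exact: mind.
  move=> z _ /=; have /andP[i0 i1] := indic01 S (ev z).
  by rewrite lee_fin !ger0_norm ?mulr_ge0 ?expR_ge0 // ler_piMl ?expR_ge0.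
(* The normalization cancels, as [c ^ theta * c ^ (1 - theta) = c]. *)
rewrite !muJ // !powRM ?(ltW c0) ?J0 //; try by move=> z; exact: expR_ge0.
rewrite mulrACA -powRD; last by rewrite subrKC oner_eq0.
by rewrite subrKC powRr1 ?(ltW c0) // ler_pM2l.
Qed.

(** * From the basic measures to their locally weak limits *)

Lemma eval_at_restr (R : realType) (K E : set (plane R)) (KE : K `<=` E) (n : nat)
    (p : 'I_n -> K) (z : borel (cfun E)) :
  eval_at p (restr KE z) = eval_at (subfun KE \o p) z.
Proof. by apply/rowP => i; rewrite !mxE. Qed.

Lemma integral_distribution_eval (R : realType) (K : set (plane R))
    (mu : probability (borel (cfun K)) R) (n : nat) (p : 'I_n -> K)
    (phi : 'rV[R]_n -> R) :
  continuous phi -> (exists M, forall z, `|phi z| <= M) ->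
  (\int[distribution mu (eval_at p)]_z (phi z)%:E =
   \int[mu]_z (phi (eval_at p z))%:E)%E.
Proof.
move=> cphi [M phiM].
have mphi : measurable_fun setT (phi : borel 'rV[R]_n -> R).
  exact: continuous_borel_real.
rewrite integral_distribution //; first exact/measurable_EFinP.
apply: (le_integrable measurableT _ _ (finite_measure_integrable_cst mu M measurableT)).
  by apply/measurable_EFinP; apply: measurableT_comp mphi _; exact: measurable_funP.
move=> z _; rewrite lee_fin /= ler_normr; apply/orP; left; exact: phiM.
Qed.

(** Continuous mapping: a bounded continuous test function composed with evaluation is again one. *)
Lemma eval_at_weak_cvg (R : realType) (K : set (plane R))
    (mu : nat -> probability (borel (cfun K)) R) (nu : probability (borel (cfun K)) R)
    (n : nat) (p : 'I_n -> K) :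
  weak_cvg mu nu ->
  weak_cvg (fun i => distribution (mu i) (eval_at p)) (distribution nu (eval_at p)).
Proof.
move=> h phi cphi bphi; under eq_fun do rewrite integral_distribution_eval //.
rewrite integral_distribution_eval //.
apply: (h (fun z => phi (eval_at p z))) => [z|].
  exact: (continuous_comp (@eval_at_continuous R K n p z) (cphi _)).
by have [M phiM] := bphi; exists M => z.
Qed.

Theorem corollary2p7 (R : realType) (Lambda : set int) (I : set R)
    (d : measure_display) (Omega : measurableType d) (P : probability Omega R)
    (L : {RV P >-> borel (cfun ((Lambda `*` I : set (plane R))))}) :
  is_interval Lambda -> is_interval I -> LC (distribution P L) ->
  forall (n : nat) (p : 'I_n -> (Lambda `*` I : set (plane R))),
    log_concave (distribution (distribution P L) (eval_at p)).
Proof.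
move=> _ _ [r [mu [basic [_ lw]]]] n p.
(* The finitely many evaluation points form a compact set, and evaluation factors through
   restriction to it. Local convergence is needed for this [K] alone, along the sequence shifted by
   [N] so that every domain contains it. *)
pose K : set (plane R) := range (set_val \o p).
have cK : compact K.
  by apply: finite_compact; exact/finite_image/finite_finset.
have KE : K `<=` Lambda `*` I by move=> _ [i _ <-]; exact: set_valP.
have [N [KD cvg]] := lw K KE cK.
have Kp i : K (set_val (p i)) by exists i.
pose p' i : K := exist _ (set_val (p i)) (mem_set (Kp i)).
have pE z : eval_at p' (restr KE z) = eval_at p z.
  rewrite eval_at_restr; congr eval_at; apply/funext => i.
  exact/val_inj.
have lc : log_concave (distribution (distribution (distribution P L) (restr KE)) (eval_at p')).
  have wc := eval_at_weak_cvg (p := p') cvg.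
  suff H : forall i (theta : R) (A B C : set (borel 'rV[R]_n)), 0 < theta < 1 ->
      measurable A -> measurable B -> measurable C ->
      (forall x y, A x -> B y -> C (theta *: (x : 'rV[R]_n) + (1 - theta) *: (y : 'rV[R]_n))) ->
      fine (distribution (distribution (mu (N + i)%N) (restr (KD i))) (eval_at p') A) `^ theta *
      fine (distribution (distribution (mu (N + i)%N) (restr (KD i))) (eval_at p') B) `^ (1 - theta)
      <= fine (distribution (distribution (mu (N + i)%N) (restr (KD i))) (eval_at p') C).
    exact: (weak_limit_log_concave H wc).
  move=> i theta A B C t01 mA mB mC ABC.
  have := basic_measure_log_concave (subfun (KD i) \o p') (basic (N + i)%N) t01 mA mB mC ABC.
  have E S : distribution (mu (N + i)%N) (eval_at (subfun (KD i) \o p')) S =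
    distribution (distribution (mu (N + i)%N) (restr (KD i))) (eval_at p') S.
    rewrite /distribution /pushforward; congr (mu _ _).
  by rewrite !E.
have E S : distribution (distribution P L) (eval_at p) S =
    distribution (distribution (distribution P L) (restr KE)) (eval_at p') S.
  rewrite /distribution /pushforward; congr (P _).
  by apply/funext => w /=; rewrite pE.
move=> A B theta A0 cA B0 cB t01.
have := lc A B theta A0 cA B0 cB t01.
rewrite -[X in (X `^ _ * _ <= _)%E -> _]E -[X in (_ * X `^ _ <= _)%E -> _]E.
by rewrite -[X in (_ <= X)%E -> _]E.
Qed.
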